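(* Let $T$ satisfy $$T>\frac{L}{\sqrt{K_v(0,0)}},$$ and consider the mixed problem $$u_{tt}-(K(u,u_x))_x=F(u,u_x,u_t),$$ $$u(0,x)=\varphi(x),\quad u_t(0,x)=\psi(x),\quad x\in[0,L],$$ $$u(t,0)-u(t,L)=h(t),\qquad u_x(t,0)-u_x(t,L)=\overline h(t).$$ If $\|(\varphi,\psi)\|_{C^2[0,L]\times C^1[0,L]}$ and $\|(h,\overline h)\|_{C^2[0,T]\times C^1[0,T]}$ are sufficiently small, and the conditions of $C^2$ compatibility are satisfied at the points $(t,x)=(0,0)$ and $(0,L)$, then the initial data $(\varphi,\psi)$ can be uniquely determined by the boundary observations $(\overline u(t),\overline v(t)):=(u(t,0),u_x(t,0))$, $t\in[0,T]$, together with the boundary functions $(h(t),\overline h(t))$. Moreover, the following observability estimate holds: $$\|(\varphi,\psi)\|_{C^2[0,L]\times C^1[0,L]}\le C\big(\|(\overline u,\overline v)\|_{C^2[0,T]\times C^1[0,T]}+\|(h,\overline h)\|_{C^2[0,T]\times C^1[0,T]}\big),$$ where $C$ is a positive constant possibly depending on $T$ (but not on the data).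
   Context: $L>0$; $K=K(u,v)$ is a $C^2$ function with $K_v(u,v)>0$, and $F=F(u,v,w)$ is a $C^1$ function with $F(0,0,0)=0$. All considerations are in a neighbourhood of $(u,u_x,u_t)=(0,0,0)$. The conditions of $C^2$ compatibility mean that the first boundary condition together with its first and second $t$-derivatives, and the second boundary condition together with its first $t$-derivative, hold at $t=0$ when $u,u_x,u_t,u_{tx}$ at $t=0$ are replaced by $\varphi,\varphi',\psi,\psi'$ and $u_{tt}(0,x)$ by $(K(\varphi,\varphi'))'+F(\varphi,\varphi',\psi)$. ''Sufficiently small'' means bounded by some $\varepsilon>0$ possibly depending on $T$; $u$ is the unique $C^2$ solution of the mixed problem with small $C^2$ norm on $[0,T]\times[0,L]$. ''Uniquely determined'' means that two admissible initial data whose solutions (with the same $(h,\overline h)$) give the same observations on $[0,T]$ coincide. *)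

(* Defs.v *)
From Stdlib Require Export Reals.
From Stdlib Require Import Lra.
From Coquelicot Require Export Coquelicot.
Open Scope R_scope.

(** * Differentiation on closed intervals and rectangles

    Derivatives are taken relative to the closed interval, hence one-sided at
    the endpoints: values of a function outside its interval play no role. *)

Definition Icc (a b x : R) : Prop := a <= x <= b.

(* [is_derive] with [locally x] restricted to [Icc a b]. *)
Definition is_derive_on (a b : R) (f : R -> R) (x l : R) : Prop :=
  filterdiff f (within (Icc a b) (locally x)) (fun y : R => scal y l).

Definition ex_derive_on (a b : R) (f : R -> R) (x : R) : Prop :=
  exists l : R, is_derive_on a b f x l.

(* Meaningful when [a < b] and [ex_derive_on a b f x], see
   [is_derive_on_unique] below; unspecified otherwise. *)
Definition Derive_on (a b : R) (f : R -> R) (x : R) : R :=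
  iota (fun l : R => is_derive_on a b f x l).

Lemma is_derive_on_eps (a b : R) (f : R -> R) (x l : R) :
  Icc a b x ->
  (is_derive_on a b f x l <->
   forall eps : posreal, exists d : posreal, forall y, Icc a b y ->
     Rabs (y - x) < d ->
     Rabs (f y - f x - (y - x) * l) <= eps * Rabs (y - x)).
Proof.
intros Hx; split.
- intros [_ H] eps.
  assert (Hlim : is_filter_lim (within (Icc a b) (locally x)) x).
  { intros P [d HP]; exists d; intros y Hy _; now apply HP. }
  destruct (H x Hlim eps) as [d Hd]; exists d; intros y Hy Hyx.
  exact (Hd y Hyx Hy).
- intros H; split; [exact (@is_linear_scal_l R_AbsRing R_NormedModule l)|].
  intros x' Hlim.
  assert (Hx' : x' = x).
  { apply Rminus_diag_uniq, Rabs_eq_0, Rle_antisym; [|apply Rabs_pos].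
    apply le_epsilon; intros e He; rewrite Rplus_0_l.
    assert (Hl : locally x' (fun z => Rabs (z - x') < e)) by
      (exists (mkposreal e He); intros z Hz; exact Hz).
    destruct (Hlim _ Hl) as [d Hd].
    rewrite Rabs_minus_sym; left.
    apply (Hd x (ball_center x d) Hx). }
  subst x'; intros eps.
  destruct (H eps) as [d Hd]; exists d; intros y Hy HIy.
  exact (Hd y HIy Hy).
Qed.

Lemma is_derive_on_unique (a b : R) (f : R -> R) (x l : R) :
  a < b -> Icc a b x -> is_derive_on a b f x l -> Derive_on a b f x = l.
Proof.
intros Hab Hx H.
apply (@iota_unique R_AbsRing R_CompleteNormedModule); [|exact H].
intros l' H'.
apply Rminus_diag_uniq, Rabs_eq_0, Rle_antisym; [|apply Rabs_pos].
apply le_epsilon; intros e He; rewrite Rplus_0_l.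
assert (He2 : 0 < e / 2) by lra.
pose proof (proj1 (is_derive_on_eps a b f x l Hx) H) as E1.
pose proof (proj1 (is_derive_on_eps a b f x l' Hx) H') as E2.
destruct (E1 (mkposreal _ He2)) as [d Hd].
destruct (E2 (mkposreal _ He2)) as [d' Hd'].
simpl in Hd, Hd'.
assert (Hy : exists y, Icc a b y /\ Rabs (y - x) < d /\
               Rabs (y - x) < d' /\ 0 < Rabs (y - x)).
{ pose proof (cond_pos d) as Pd; pose proof (cond_pos d') as Pd'.
  unfold Icc in *.
  set (m := Rmin (Rmin d d') (b - a) / 2).
  assert (Hm : 0 < m /\ m < d /\ m < d' /\ 2 * m <= b - a).
  { unfold m, Rmin; repeat destruct (Rle_dec _ _); lra. }
  destruct (Rle_dec (x + m) b).
  - exists (x + m); replace (x + m - x) with m by ring.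
    rewrite (Rabs_pos_eq m) by lra; lra.
  - exists (x - m); replace (x - m - x) with (- m) by ring.
    rewrite Rabs_Ropp, (Rabs_pos_eq m) by lra; lra. }
destruct Hy as [y [HI [H1 [H2 H3]]]].
specialize (Hd y HI H1); specialize (Hd' y HI H2).
apply Rmult_le_reg_r with (Rabs (y - x)); [exact H3|].
rewrite <- Rabs_mult.
replace ((l' - l) * (y - x)) with
  ((f y - f x - (y - x) * l) - (f y - f x - (y - x) * l')) by ring.
eapply Rle_trans; [apply Rabs_triang|]; rewrite Rabs_Ropp; lra.
Qed.

Definition C1_on (a b : R) (f : R -> R) : Prop :=
  (forall x, Icc a b x -> ex_derive_on a b f x) /\
  continuous_on (Icc a b) (Derive_on a b f).

Definition C2_on (a b : R) (f : R -> R) : Prop :=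
  C1_on a b f /\ C1_on a b (Derive_on a b f).

Definition rect (T L : R) (p : R * R) : Prop :=
  Icc 0 T (fst p) /\ Icc 0 L (snd p).

Definition D_t (T : R) (u : R -> R -> R) (t x : R) : R :=
  Derive_on 0 T (fun s => u s x) t.

Definition D_x (L : R) (u : R -> R -> R) (t x : R) : R :=
  Derive_on 0 L (fun y => u t y) x.

Definition C1_rect (T L : R) (u : R -> R -> R) : Prop :=
  (forall t x, rect T L (t, x) ->
     ex_derive_on 0 T (fun s => u s x) t /\
     ex_derive_on 0 L (fun y => u t y) x) /\
  continuous_on (rect T L) (fun p => u (fst p) (snd p)) /\
  continuous_on (rect T L) (fun p => D_t T u (fst p) (snd p)) /\
  continuous_on (rect T L) (fun p => D_x L u (fst p) (snd p)).

Definition C2_rect (T L : R) (u : R -> R -> R) : Prop :=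
  C1_rect T L u /\ C1_rect T L (D_t T u) /\ C1_rect T L (D_x L u).

(** * Norms *)

(* [real] sends infinite values to 0, so these are the actual norms only for
   functions of the corresponding regularity. *)
Definition sup_norm (a b : R) (f : R -> R) : R :=
  real (Lub_Rbar (fun y => exists x, Icc a b x /\ y = Rabs (f x))).

Definition C1_norm (a b : R) (f : R -> R) : R :=
  sup_norm a b f + sup_norm a b (Derive_on a b f).

Definition C2_norm (a b : R) (f : R -> R) : R :=
  sup_norm a b f + C1_norm a b (Derive_on a b f).

Definition C2C1_norm (a b : R) (f g : R -> R) : R :=
  C2_norm a b f + C1_norm a b g.

Definition sup_norm_rect (T L : R) (u : R -> R -> R) : R :=
  real (Lub_Rbar
    (fun y => exists t x, rect T L (t, x) /\ y = Rabs (u t x))).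

(* The mixed derivative is counted once, as [u_tx = u_xt] for [C2_rect]. *)
Definition C2_norm_rect (T L : R) (u : R -> R -> R) : R :=
  sup_norm_rect T L u +
  sup_norm_rect T L (D_t T u) +
  sup_norm_rect T L (D_x L u) +
  sup_norm_rect T L (D_t T (D_t T u)) +
  sup_norm_rect T L (D_x L (D_t T u)) +
  sup_norm_rect T L (D_x L (D_x L u)).

(** * The coefficients, near the origin *)

Definition K_v (K : R -> R -> R) (a b : R) : R := Derive (fun z => K a z) b.

Definition C2_near0 (r : R) (K : R -> R -> R) : Prop :=
  forall a b, Rabs a < r -> Rabs b < r -> ex_diff_n K 2 a b.

Definition box3 (r : R) (p : R * R * R) : Prop :=
  Rabs (fst (fst p)) < r /\ Rabs (snd (fst p)) < r /\ Rabs (snd p) < r.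

Definition C1_near0 (r : R) (F : R -> R -> R -> R) : Prop :=
  (forall a b c, box3 r (a, b, c) ->
     ex_derive (fun z => F z b c) a /\
     ex_derive (fun z => F a z c) b /\
     ex_derive (fun z => F a b z) c) /\
  continuous_on (box3 r) (fun p : R * R * R =>
    let '(a, b, c) := p in F a b c) /\
  continuous_on (box3 r) (fun p : R * R * R =>
    let '(a, b, c) := p in Derive (fun z => F z b c) a) /\
  continuous_on (box3 r) (fun p : R * R * R =>
    let '(a, b, c) := p in Derive (fun z => F a z c) b) /\
  continuous_on (box3 r) (fun p : R * R * R =>
    let '(a, b, c) := p in Derive (fun z => F a b z) c).

(** * The mixed problem *)

(* The value of [u_tt] at [t = 0] forced by the equation. *)
Definition utt0 (K : R -> R -> R) (F : R -> R -> R -> R) (L : R)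
    (phi psi : R -> R) (x : R) : R :=
  Derive_on 0 L (fun y => K (phi y) (Derive_on 0 L phi y)) x
  + F (phi x) (Derive_on 0 L phi x) (psi x).

Definition C2_compatible (K : R -> R -> R) (F : R -> R -> R -> R) (T L : R)
    (phi psi h hbar : R -> R) : Prop :=
  phi 0 - phi L = h 0 /\
  psi 0 - psi L = Derive_on 0 T h 0 /\
  utt0 K F L phi psi 0 - utt0 K F L phi psi L
    = Derive_on 0 T (Derive_on 0 T h) 0 /\
  Derive_on 0 L phi 0 - Derive_on 0 L phi L = hbar 0 /\
  Derive_on 0 L psi 0 - Derive_on 0 L psi L = Derive_on 0 T hbar 0.

Definition small_data (K : R -> R -> R) (F : R -> R -> R -> R) (T L eps : R)
    (phi psi h hbar : R -> R) : Prop :=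
  C2_on 0 L phi /\ C1_on 0 L psi /\ C2_on 0 T h /\ C1_on 0 T hbar /\
  C2C1_norm 0 L phi psi <= eps /\
  C2C1_norm 0 T h hbar <= eps /\
  C2_compatible K F T L phi psi h hbar.

Definition solves (K : R -> R -> R) (F : R -> R -> R -> R) (T L : R)
    (phi psi h hbar : R -> R) (u : R -> R -> R) : Prop :=
  C2_rect T L u /\
  (forall t x, rect T L (t, x) ->
     D_t T (D_t T u) t x - D_x L (fun s y => K (u s y) (D_x L u s y)) t x
     = F (u t x) (D_x L u t x) (D_t T u t x)) /\
  (forall x, Icc 0 L x -> u 0 x = phi x /\ D_t T u 0 x = psi x) /\
  (forall t, Icc 0 T t ->
     u t 0 - u t L = h t /\ D_x L u t 0 - D_x L u t L = hbar t).

Definition small_solution (K : R -> R -> R) (F : R -> R -> R -> R)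
    (T L delta : R) (phi psi h hbar : R -> R) (u : R -> R -> R) : Prop :=
  solves K F T L phi psi h hbar u /\ C2_norm_rect T L u <= delta.

(* The boundary observations [u(t,0)] and [u_x(t,0)]. *)
Definition obs_u (u : R -> R -> R) (t : R) : R := u t 0.
Definition obs_v (L : R) (u : R -> R -> R) (t : R) : R := D_x L u t 0.

(* Main.v *)
Require Import Defs.
From Stdlib Require Import Reals.
From Coquelicot Require Import Coquelicot.
From Stdlib Require Import Lra Classical ClassicalEpsilon.
Open Scope R_scope.

(** Information travels at speeds close to [sqrt (K_v 0 0)], and Cauchy data are
    known on both lateral sides: [u] and [u_x] are observed at [x = 0], and the
    boundary conditions transfer them to [x = L]. Since [T > L / sqrt (K_v 0 0)],
    the triangles of determinacy of the two sides together cover the segment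
    [t = T / 2]. From there the solution is determined backwards in time, as the
    lateral values are known, down to [t = 0].

    The quantitative form concerns the difference [U] of two small solutions. It
    satisfies [|U_tt - a * U_xx| <= M * (|U| + |U_t| + |U_x|)] with
    [a = K_v (u1, u1_x)] ([difference_wave_ineq]). The sup norm estimate for [U]
    and its gradient comes from a maximum principle for the Riemann invariants
    [U_t + l * U_x] and [U_t - l * U_x], [l ^ 2 = a], multiplied by an exponential
    weight ([weighted_maximum]): at a maximum, a short straight step along a
    characteristic direction, forwards or backwards in time, would increase the
    weighted quantity, so no characteristic curve is ever constructed. It is
    applied to each triangle ([triangle_estimate]) and then to
    [[0, T / 2] x [0, L]] ([lateral_to_initial]), which gives
    [difference_estimate].

    Two solutions with the same observations have a zero difference on the
    sides, hence at [t = 0]. Comparing a solution with zero gives the first-order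
    part of the observability estimate; comparing it with its translates in time
    and dividing by the length of the translation bounds [u_tt] and [u_tx], and
    the equation then gives [u_xx] ([initial_jet_estimate]). *)

(** * One-sided calculus on closed intervals *)

Lemma is_derive_on_mono (a b a' b' : R) (f : R -> R) (x l : R) :
  a <= a' -> b' <= b -> Icc a' b' x ->
  is_derive_on a b f x l -> is_derive_on a' b' f x l.
Proof.
  intros Ha Hb Hx H; apply is_derive_on_eps; [exact Hx|].
  assert (Hx' : Icc a b x) by (unfold Icc in *; lra).
  intros eps; destruct (proj1 (is_derive_on_eps _ _ _ _ _ Hx') H eps) as [d Hd].
  exists d; intros y Hy; apply Hd; unfold Icc in *; lra.
Qed.

Lemma is_derive_on_shift (a b s : R) (f : R -> R) (x l : R) :
  Icc a b x -> is_derive_on (a + s) (b + s) f (x + s) l ->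
  is_derive_on a b (fun y => f (y + s)) x l.
Proof.
  intros Hx H; apply is_derive_on_eps; [exact Hx|].
  assert (Hx' : Icc (a + s) (b + s) (x + s)) by (unfold Icc in *; lra).
  intros eps; destruct (proj1 (is_derive_on_eps _ _ _ _ _ Hx') H eps) as [d Hd].
  exists d; intros y Hy Hyx.
  replace (y - x) with ((y + s) - (x + s)) in * by ring.
  apply Hd; [unfold Icc in *; lra|exact Hyx].
Qed.

Lemma is_derive_on_minus (a b : R) (f g : R -> R) (x l m : R) :
  is_derive_on a b f x l -> is_derive_on a b g x m ->
  is_derive_on a b (fun y => f y - g y) x (l - m).
Proof.
  intros Hf Hg.
  pose proof (filterdiff_minus_fct _ _ _ _ Hf Hg) as H.
  eapply filterdiff_ext_lin; [exact H|].
  intros y; unfold scal, minus, plus, opp; simpl; unfold mult; simpl; ring.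
Qed.

Lemma is_derive_on_const (a b c x : R) : is_derive_on a b (fun _ => c) x 0.
Proof.
  eapply filterdiff_ext_lin; [exact (filterdiff_const c)|].
  intros y; unfold scal; simpl; unfold mult, zero; simpl; ring.
Qed.

Lemma is_derive_on_ext (a b : R) (f g : R -> R) (x l : R) :
  Icc a b x -> (forall y, Icc a b y -> f y = g y) ->
  is_derive_on a b f x l -> is_derive_on a b g x l.
Proof.
  intros Hx Hfg H; apply is_derive_on_eps; [exact Hx|].
  intros eps; destruct (proj1 (is_derive_on_eps _ _ _ _ _ Hx) H eps) as [d Hd].
  exists d; intros y Hy; rewrite <- !Hfg by assumption; exact (Hd y Hy).
Qed.

Lemma Derive_on_correct (a b : R) (f : R -> R) (x : R) :
  a < b -> Icc a b x -> ex_derive_on a b f x ->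
  is_derive_on a b f x (Derive_on a b f x).
Proof.
  intros Hab Hx [l Hl].
  now rewrite (is_derive_on_unique a b f x l Hab Hx Hl).
Qed.

Lemma is_derive_on_lip (a b : R) (f : R -> R) (x l : R) :
  Icc a b x -> is_derive_on a b f x l ->
  exists d : posreal, forall y, Icc a b y -> Rabs (y - x) < d ->
    Rabs (f y - f x) <= (Rabs l + 1) * Rabs (y - x).
Proof.
  intros Hx H.
  destruct (proj1 (is_derive_on_eps _ _ _ _ _ Hx) H (mkposreal 1 Rlt_0_1))
    as [d Hd].
  exists d; intros y Hy Hyx; specialize (Hd y Hy Hyx); simpl in Hd.
  replace (f y - f x) with ((f y - f x - (y - x) * l) + (y - x) * l) by ring.
  eapply Rle_trans; [apply Rabs_triang|]; rewrite Rabs_mult; lra.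
Qed.

Lemma is_derive_on_interior (a b : R) (f : R -> R) (x l : R) :
  a < x < b -> is_derive_on a b f x l -> is_derive f x l.
Proof.
  intros Hx H; apply is_derive_Reals; intros e He.
  assert (HI : Icc a b x) by (unfold Icc; lra).
  assert (He2 : 0 < e / 2) by lra.
  destruct (proj1 (is_derive_on_eps _ _ _ _ _ HI) H (mkposreal _ He2))
    as [d Hd]; simpl in Hd.
  assert (Hm : 0 < Rmin d (Rmin (x - a) (b - x))).
  { repeat apply Rmin_pos; try apply cond_pos; lra. }
  exists (mkposreal _ Hm); simpl; intros h Hh Hlt.
  pose proof (Rmin_l d (Rmin (x - a) (b - x))).
  pose proof (Rmin_r d (Rmin (x - a) (b - x))).
  pose proof (Rmin_l (x - a) (b - x)).
  pose proof (Rmin_r (x - a) (b - x)).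
  assert (Hy : Icc a b (x + h)).
  { apply Rabs_def2 in Hlt; unfold Icc; lra. }
  specialize (Hd (x + h) Hy).
  replace (x + h - x) with h in Hd by ring.
  assert (Hpos : 0 < Rabs h) by now apply Rabs_pos_lt.
  replace ((f (x + h) - f x) / h - l) with ((f (x + h) - f x - h * l) / h)
    by (field; exact Hh).
  unfold Rdiv at 1; rewrite Rabs_mult, Rabs_inv.
  apply Rmult_lt_reg_r with (Rabs h); [exact Hpos|].
  rewrite Rmult_assoc, Rinv_l, Rmult_1_r by lra.
  specialize (Hd ltac:(lra)); nra.
Qed.

(** The mean value theorem is applied to [f] composed with the projection onto
    [Icc a b], which is continuous on the whole line even when [f] jumps at the
    endpoints. *)
Lemma mean_value_on (a b : R) (f f' : R -> R) (x y : R) :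
  (forall z, Icc a b z -> is_derive_on a b f z (f' z)) ->
  Icc a b x -> Icc a b y ->
  exists z, Icc a b z /\ Rmin x y <= z <= Rmax x y /\
    f y - f x = f' z * (y - x).
Proof.
  intros H Hx Hy.
  set (p := fun z => Rmax a (Rmin b z)).
  assert (Hp : forall z, Icc a b z -> p z = z).
  { intros z Hz; unfold p, Icc, Rmax, Rmin in *.
    destruct (Rle_dec b z), (Rle_dec a _); lra. }
  assert (Hm : a <= Rmin x y /\ Rmax x y <= b).
  { unfold Icc in *; split; [apply Rmin_glb|apply Rmax_lub]; lra. }
  destruct (MVT_gen (fun z => f (p z)) x y f') as [z [Hz E]].
  - intros z Hz.
    apply is_derive_ext_loc with f.
    + assert (Hlt : 0 < Rmin (z - a) (b - z)) by (apply Rmin_pos; lra).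
      exists (mkposreal _ Hlt); intros w Hw.
      change (Rabs (w - z) < Rmin (z - a) (b - z)) in Hw.
      pose proof (Rmin_l (z - a) (b - z)); pose proof (Rmin_r (z - a) (b - z)).
      apply Rabs_def2 in Hw; rewrite Hp; [reflexivity|unfold Icc; lra].
    + apply is_derive_on_interior with a b; [lra|].
      apply H; unfold Icc; lra.
  - intros z Hz.
    assert (HzI : Icc a b z) by (unfold Icc; lra).
    destruct (is_derive_on_lip _ _ _ _ _ HzI (H z HzI)) as [d Hd].
    set (M := Rabs (f' z) + 1) in *.
    assert (HM : 0 < M) by (unfold M; pose proof (Rabs_pos (f' z)); lra).
    intros e He.
    exists (Rmin d (e / M)); split.
    { apply Rmin_pos; [apply cond_pos|now apply Rdiv_lt_0_compat]. }
    intros w [_ Hw]; change (Rabs (w - z) < Rmin d (e / M)) in Hw.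
    change (Rabs (f (p w) - f (p z)) < e).
    pose proof (Rmin_l d (e / M)); pose proof (Rmin_r d (e / M)).
    rewrite (Hp z HzI).
    assert (Hpw : Icc a b (p w) /\ Rabs (p w - z) <= Rabs (w - z)).
    { unfold p, Icc, Rmax, Rmin in *.
      destruct (Rle_dec b w), (Rle_dec a _); split; try lra;
        unfold Rabs; repeat destruct (Rcase_abs _); lra. }
    destruct Hpw as [HI Hle].
    eapply Rle_lt_trans; [apply Hd; [exact HI|lra]|].
    apply Rmult_lt_reg_r with (/ M); [now apply Rinv_0_lt_compat|].
    replace (M * Rabs (p w - z) * / M) with (Rabs (p w - z)) by (field; lra).
    unfold Rdiv in *; lra.
  - exists z; rewrite !Hp in E by assumption.
    split; [unfold Icc; lra|]; split; assumption.
Qed.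

Lemma lipschitz_on (a b M : R) (f f' : R -> R) (x y : R) :
  (forall z, Icc a b z -> is_derive_on a b f z (f' z)) ->
  (forall z, Icc a b z -> Rabs (f' z) <= M) ->
  Icc a b x -> Icc a b y -> Rabs (f y - f x) <= M * Rabs (y - x).
Proof.
  intros H HM Hx Hy.
  destruct (mean_value_on a b f f' x y H Hx Hy) as [z [Hz [_ E]]].
  rewrite E, Rabs_mult; apply Rmult_le_compat_r; [apply Rabs_pos|auto].
Qed.

(** Applied to traces at [x] fixed, this turns an estimate for the difference of
    a solution and its translate in time, linear in the length of the
    translation, into an estimate for second derivatives. *)
Lemma derivative_bound (b : R) (f : R -> R) (l M s0 : R) :
  0 < b -> 0 < s0 -> is_derive_on 0 b f 0 l ->
  (forall s, 0 < s < s0 -> Rabs (f s - f 0) <= M * s) -> Rabs l <= M.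
Proof.
  intros Hb Hs0 H HM; apply le_epsilon; intros e He.
  assert (H0 : Icc 0 b 0) by (unfold Icc; lra).
  destruct (proj1 (is_derive_on_eps _ _ _ _ _ H0) H (mkposreal e He))
    as [d Hd]; simpl in Hd.
  pose proof (cond_pos d) as Pd.
  set (s := Rmin (Rmin d s0) b / 2).
  assert (Hs : 0 < s /\ s < d /\ s < s0 /\ s <= b).
  { unfold s, Rmin; repeat destruct (Rle_dec _ _); lra. }
  assert (HsI : Icc 0 b s) by (unfold Icc; lra).
  specialize (Hd s HsI); specialize (HM s ltac:(lra)).
  rewrite Rminus_0_r, (Rabs_pos_eq s) in Hd by lra.
  specialize (Hd ltac:(lra)).
  apply Rmult_le_reg_r with s; [lra|].
  replace (Rabs l * s) with (Rabs (s * l))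
    by (rewrite Rabs_mult, (Rabs_pos_eq s) by lra; ring).
  replace (s * l) with ((f s - f 0) - (f s - f 0 - s * l)) by ring.
  eapply Rle_trans; [apply Rabs_triang|]; rewrite Rabs_Ropp; lra.
Qed.

(** * Compactness and jets on a rectangle *)

Definition cont_rect (T L : R) (f : R -> R -> R) : Prop :=
  continuous_on (rect T L) (fun p => f (fst p) (snd p)).

Lemma cont_rect_eps (T L : R) (f : R -> R -> R) (t x e : R) :
  cont_rect T L f -> rect T L (t, x) -> 0 < e ->
  exists d : posreal, forall s y, rect T L (s, y) ->
    Rabs (s - t) < d -> Rabs (y - x) < d -> Rabs (f s y - f t x) < e.
Proof.
  intros Hf Hp He.
  destruct (proj1 (filterlim_locally _ _) (Hf (t, x) Hp) (mkposreal e He))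
    as [d Hd].
  exists d; intros s y Hsy Hs Hy; exact (Hd (s, y) (conj Hs Hy) Hsy).
Qed.

Lemma cont_rect_op (T L : R) (op : R -> R -> R) (f g : R -> R -> R) :
  (forall a b, filterlim (fun z => op (fst z) (snd z))
     (filter_prod (locally a) (locally b)) (locally (op a b))) ->
  cont_rect T L f -> cont_rect T L g ->
  cont_rect T L (fun t x => op (f t x) (g t x)).
Proof.
  intros Hop Hf Hg p Hp.
  exact (filterlim_comp_2 _ _ _ (Hf p Hp) (Hg p Hp) (Hop _ _)).
Qed.

Lemma cont_rect_plus (T L : R) (f g : R -> R -> R) :
  cont_rect T L f -> cont_rect T L g ->
  cont_rect T L (fun t x => f t x + g t x).
Proof.
  apply cont_rect_op; intros a b; exact (@filterlim_plus _ R_NormedModule a b).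
Qed.

Lemma cont_rect_mult (T L : R) (f g : R -> R -> R) :
  cont_rect T L f -> cont_rect T L g ->
  cont_rect T L (fun t x => f t x * g t x).
Proof.
  apply cont_rect_op; intros a b; exact (@filterlim_mult R_AbsRing a b).
Qed.

Lemma cont_rect_max (T L : R) (f g : R -> R -> R) :
  cont_rect T L f -> cont_rect T L g ->
  cont_rect T L (fun t x => Rmax (f t x) (g t x)).
Proof.
  apply cont_rect_op; intros a b.
  apply (proj2 (filterlim_locally _ _)); intros e.
  exists (ball a e) (ball b e); [apply locally_ball|apply locally_ball|].
  intros z w Hz Hw.
  change (Rabs (z - a) < e) in Hz; change (Rabs (w - b) < e) in Hw.
  change (Rabs (Rmax z w - Rmax a b) < e).
  unfold Rmax; apply Rabs_def2 in Hz; apply Rabs_def2 in Hw; apply Rabs_def1;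
    destruct (Rle_dec z w), (Rle_dec a b); lra.
Qed.

Lemma cont_rect_comp (T L : R) (g : R -> R) (f : R -> R -> R) :
  (forall a, continuous g a) -> cont_rect T L f ->
  cont_rect T L (fun t x => g (f t x)).
Proof.
  intros Hg Hf p Hp; exact (filterlim_comp _ _ _ _ _ _ _ _ (Hf p Hp) (Hg _)).
Qed.

Definition lip_rect (T L M : R) (f : R -> R -> R) : Prop :=
  forall t x s y, rect T L (t, x) -> rect T L (s, y) ->
    Rabs (f s y - f t x) <= M * (Rabs (s - t) + Rabs (y - x)).

Lemma lip_rect_cont (T L M : R) (f : R -> R -> R) :
  0 <= M -> lip_rect T L M f -> cont_rect T L f.
Proof.
  intros HM Hf [t x] Hp; apply (proj2 (filterlim_locally _ _)); intros e.
  pose proof (cond_pos e).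
  assert (Hd : 0 < e / (2 * M + 1)) by (apply Rdiv_lt_0_compat; lra).
  exists (mkposreal _ Hd); intros [s y] [Hs Hy] Hq.
  change (Rabs (s - t) < e / (2 * M + 1)) in Hs.
  change (Rabs (y - x) < e / (2 * M + 1)) in Hy.
  change (Rabs (f s y - f t x) < e).
  pose proof (Hf t x s y Hp Hq).
  assert (pos e = (2 * M + 1) * (e / (2 * M + 1))) by (field; lra).
  set (k := e / (2 * M + 1)) in *; nra.
Qed.

(** A Lebesgue number argument: the radius attached to a point also measures how
    well [Q] holds around it, and compactness keeps it away from 0. *)
Lemma rect_uniform (T L : R) (Q : R -> R -> R -> Prop) :
  (forall d d' s y, 0 < d' <= d -> Q d s y -> Q d' s y) ->
  (forall t x, rect T L (t, x) -> exists d : posreal, forall s y,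
     rect T L (s, y) -> Rabs (s - t) < d -> Rabs (y - x) < d -> Q d s y) ->
  exists d : posreal, forall s y, rect T L (s, y) -> Q d s y.
Proof.
  intros Hmono Hloc.
  assert (Hd : forall t x, exists d : posreal, rect T L (t, x) -> forall s y,
     rect T L (s, y) -> Rabs (s - t) < d -> Rabs (y - x) < d -> Q d s y).
  { intros t x; destruct (classic (rect T L (t, x))) as [H|H].
    - destruct (Hloc t x H) as [d Hd]; now exists d.
    - exists (mkposreal 1 Rlt_0_1); easy. }
  set (delta := fun t x =>
    proj1_sig (constructive_indefinite_description _ (Hd t x))).
  assert (Hdelta : forall t x, rect T L (t, x) -> forall s y,
     rect T L (s, y) -> Rabs (s - t) < delta t x -> Rabs (y - x) < delta t x ->
     Q (delta t x) s y).
  { intros t x; unfold delta.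
    destruct (constructive_indefinite_description _ (Hd t x)) as [d Hd']; exact Hd'. }
  destruct (compactness_value_2d 0 T 0 L delta) as [d Hc].
  exists d; intros s y Hsy.
  destruct (NNPP _ (Hc s y (proj1 Hsy) (proj2 Hsy)))
    as [u [v [Hu [Hv [H1 [H2 H3]]]]]].
  apply (Hmono (delta u v)); [split; [apply cond_pos|exact H3]|].
  apply Hdelta; [split|..]; assumption.
Qed.

Definition closed_in_rect (T L : R) (Dom : R -> R -> Prop) : Prop :=
  (forall t x, Dom t x -> rect T L (t, x)) /\
  (forall t x, rect T L (t, x) -> ~ Dom t x -> exists d : posreal, forall s y,
     Rabs (s - t) < d -> Rabs (y - x) < d -> ~ Dom s y).

(** If the supremum [S] were not attained, every point would have a
    neighbourhood on which the function stays below [S] by a positive margin,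
    and compactness would make the margin uniform. *)
Lemma max_attained (T L : R) (Dom : R -> R -> Prop) (f : R -> R -> R) :
  closed_in_rect T L Dom -> cont_rect T L f -> (exists t x, Dom t x) ->
  exists t x, Dom t x /\ forall s y, Dom s y -> f s y <= f t x.
Proof.
  intros [Hsub Hcl] Hf [t0 [x0 H0]].
  destruct (rect_uniform T L (fun d s y => Dom s y -> f s y <= / d)) as [d Hd].
  { intros d d' s y Hdd HQ HO; eapply Rle_trans; [exact (HQ HO)|].
    apply Rinv_le_contravar; lra. }
  { intros t x Hp.
    destruct (cont_rect_eps T L f t x 1 Hf Hp Rlt_0_1) as [d Hd].
    assert (HM : 0 < Rabs (f t x) + 1) by (pose proof (Rabs_pos (f t x)); lra).
    assert (Hm : 0 < Rmin d (/ (Rabs (f t x) + 1))).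
    { apply Rmin_pos; [apply cond_pos|now apply Rinv_0_lt_compat]. }
    exists (mkposreal _ Hm); simpl; intros s y Hq Hs Hy _.
    pose proof (Rmin_l d (/ (Rabs (f t x) + 1))).
    pose proof (Rmin_r d (/ (Rabs (f t x) + 1))).
    specialize (Hd s y Hq ltac:(lra) ltac:(lra)); apply Rabs_def2 in Hd.
    apply Rle_trans with (Rabs (f t x) + 1).
    - pose proof (Rle_abs (f t x)); lra.
    - rewrite <- (Rinv_inv (Rabs (f t x) + 1)) at 1.
      apply Rinv_le_contravar; assumption. }
  set (E := fun r => exists t x, Dom t x /\ r = f t x).
  destruct (completeness E) as [S [HS1 HS2]].
  { exists (/ d); intros r [t [x [HO ->]]]; auto. }
  { exists (f t0 x0), t0, x0; auto. }
  apply NNPP; intros Hno.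
  assert (Hlt : forall t x, Dom t x -> f t x < S).
  { intros t x HO; destruct (Rlt_or_le (f t x) S) as [|Hle]; [assumption|].
    exfalso; apply Hno; exists t, x; split; [exact HO|].
    intros s y Hs; apply Rle_trans with S; [|exact Hle].
    apply HS1; now exists s, y. }
  destruct (rect_uniform T L (fun d s y => Dom s y -> f s y <= S - d))
    as [d' Hd'].
  { intros e e' s y He HQ HO; specialize (HQ HO); lra. }
  { intros t x Hp; destruct (classic (Dom t x)) as [HO|HO].
    - pose proof (Hlt t x HO).
      assert (He : 0 < (S - f t x) / 2) by lra.
      destruct (cont_rect_eps T L f t x _ Hf Hp He) as [e Hd'].
      assert (Hm : 0 < Rmin e ((S - f t x) / 2)).
      { apply Rmin_pos; [apply cond_pos|lra]. }
      exists (mkposreal _ Hm); simpl; intros s y Hq Hs Hy _.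
      pose proof (Rmin_l e ((S - f t x) / 2)).
      pose proof (Rmin_r e ((S - f t x) / 2)).
      specialize (Hd' s y Hq ltac:(lra) ltac:(lra)); apply Rabs_def2 in Hd'.
      lra.
    - destruct (Hcl t x Hp HO) as [e He]; exists e.
      intros s y _ Hs Hy HO'; exfalso; exact (He s y Hs Hy HO'). }
  pose proof (cond_pos d').
  assert (S <= S - d'); [|lra].
  apply HS2; intros r [t [x [HO ->]]]; apply Hd'; auto.
Qed.

Lemma cont_rect_bounded (T L : R) (f : R -> R -> R) :
  cont_rect T L f ->
  exists M, forall t x, rect T L (t, x) -> Rabs (f t x) <= M.
Proof.
  intros Hf.
  destruct (classic (exists t x, rect T L (t, x))) as [Hne|Hne].
  - destruct (max_attained T L (fun t x => rect T L (t, x))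
      (fun t x => Rabs (f t x))) as [t [x [_ H]]].
    + split; [trivial|]; intros t x H H'; contradiction.
    + now apply cont_rect_comp; [exact continuous_Rabs|].
    + exact Hne.
    + now exists (Rabs (f t x)).
  - exists 0; intros t x H; exfalso; apply Hne; now exists t, x.
Qed.

(** Carrying the derivatives as functions makes differences, restrictions and
    time translations of solutions computable, whereas [Derive_on] depends on
    the interval. One field [d_tx] stands for both mixed derivatives. *)
Record jet := Jet {
  val : R -> R -> R;
  d_t : R -> R -> R;
  d_x : R -> R -> R;
  d_tt : R -> R -> R;
  d_tx : R -> R -> R;
  d_xx : R -> R -> R }.

Definition C1_jet (T L : R) (f ft fx : R -> R -> R) : Prop :=
  (forall t x, rect T L (t, x) ->
     is_derive_on 0 T (fun s => f s x) t (ft t x) /\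
     is_derive_on 0 L (fun y => f t y) x (fx t x)) /\
  cont_rect T L f /\ cont_rect T L ft /\ cont_rect T L fx.

Definition C2_jet (T L : R) (J : jet) : Prop :=
  C1_jet T L (val J) (d_t J) (d_x J) /\
  C1_jet T L (d_t J) (d_tt J) (d_tx J) /\
  C1_jet T L (d_x J) (d_tx J) (d_xx J).

Lemma C1_jet_lip (T L M : R) (f ft fx : R -> R -> R) :
  C1_jet T L f ft fx ->
  (forall t x, rect T L (t, x) -> Rabs (ft t x) <= M /\ Rabs (fx t x) <= M) ->
  lip_rect T L M f.
Proof.
  intros [H _] HM t x s y Hp Hq.
  unfold rect in *; simpl in *.
  replace (f s y - f t x) with ((f s y - f t y) + (f t y - f t x)) by ring.
  eapply Rle_trans; [apply Rabs_triang|].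
  rewrite Rmult_plus_distr_l; apply Rplus_le_compat.
  - apply (lipschitz_on 0 T M (fun s => f s y) (fun s => ft s y)); try tauto.
    + intros z Hz; apply H; tauto.
    + intros z Hz; apply HM; tauto.
  - apply (lipschitz_on 0 L M (fun y => f t y) (fun y => fx t y)); try tauto.
    + intros z Hz; apply H; tauto.
    + intros z Hz; apply HM; tauto.
Qed.

Lemma Rabs_between (z x y h : R) :
  Rmin x y <= z <= Rmax x y -> Rabs (y - x) < h -> Rabs (z - x) < h.
Proof.
  intros [H1 H2] H; apply Rabs_def2 in H.
  unfold Rmin, Rmax in *; destruct (Rle_dec x y); apply Rabs_def1; lra.
Qed.

(** Straight steps suffice for the maximum principle below, where they replace
    the characteristic curves; the estimate must hold up to the edges of the
    rectangle, hence the path through the corner [(t, x + s * b)]. *)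
Lemma C1_jet_directional (T L : R) (f ft fx : R -> R -> R) (t x a b s0 e : R) :
  C1_jet T L f ft fx -> rect T L (t, x) -> 0 < s0 -> 0 < e ->
  (forall s, 0 < s < s0 -> rect T L (t + s * a, x + s * b)) ->
  exists s1, 0 < s1 <= s0 /\ forall s, 0 < s < s1 ->
    Rabs (f (t + s * a) (x + s * b) - f t x - s * (a * ft t x + b * fx t x))
      <= e * s.
Proof.
  intros [Hd [_ [Hct Hcx]]] Hp Hs0 He Hray.
  set (N := Rabs a + Rabs b + 1).
  pose proof (Rabs_pos a); pose proof (Rabs_pos b).
  assert (HN : 0 < N) by (unfold N; lra).
  assert (HeN : 0 < e / N) by now apply Rdiv_lt_0_compat.
  destruct (cont_rect_eps T L ft t x _ Hct Hp HeN) as [d1 Hd1].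
  destruct (cont_rect_eps T L fx t x _ Hcx Hp HeN) as [d2 Hd2].
  set (d := Rmin d1 d2).
  assert (Hdpos : 0 < d) by (apply Rmin_pos; apply cond_pos).
  assert (HdN : 0 < d / N) by now apply Rdiv_lt_0_compat.
  exists (Rmin s0 (d / N)); split.
  { split; [now apply Rmin_pos|apply Rmin_l]. }
  intros s [Hs Hs'].
  pose proof (Rmin_l s0 (d / N)); pose proof (Rmin_r s0 (d / N)).
  pose proof (Rmin_l d1 d2); pose proof (Rmin_r d1 d2); fold d in H3, H4.
  pose proof (Hray s ltac:(lra)) as Hq.
  assert (HsN : s * N < d).
  { apply Rmult_lt_reg_r with (/ N); [now apply Rinv_0_lt_compat|].
    rewrite Rmult_assoc, Rinv_r, Rmult_1_r by lra; unfold Rdiv in *; lra. }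
  assert (Ha : Rabs (t + s * a - t) < d).
  { replace (t + s * a - t) with (s * a) by ring.
    rewrite Rabs_mult, Rabs_pos_eq by lra; unfold N in *; nra. }
  assert (Hb : Rabs (x + s * b - x) < d).
  { replace (x + s * b - x) with (s * b) by ring.
    rewrite Rabs_mult, Rabs_pos_eq by lra; unfold N in *; nra. }
  unfold rect in *; simpl in *.
  destruct (mean_value_on 0 T (fun s' => f s' (x + s * b))
    (fun s' => ft s' (x + s * b)) t (t + s * a)) as [z [Hz1 [Hz2 Ez]]];
    [intros w Hw; apply Hd; tauto|tauto|tauto|].
  destruct (mean_value_on 0 L (fun y => f t y)
    (fun y => fx t y) x (x + s * b)) as [w [Hw1 [Hw2 Ew]]];
    [intros v Hv; apply Hd; tauto|tauto|tauto|].
  pose proof (Rabs_between _ _ _ _ Hz2 Ha) as Hz3.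
  pose proof (Rabs_between _ _ _ _ Hw2 Hb) as Hw3.
  specialize (Hd1 z (x + s * b) ltac:(tauto) ltac:(lra) ltac:(lra)).
  specialize (Hd2 t w ltac:(tauto)
    ltac:(rewrite Rminus_diag, Rabs_R0; apply cond_pos) ltac:(lra)).
  replace (f (t + s * a) (x + s * b) - f t x - s * (a * ft t x + b * fx t x))
    with ((s * a) * (ft z (x + s * b) - ft t x)
          + (s * b) * (fx t w - fx t x))
    by (replace (t + s * a - t) with (s * a) in Ez by ring;
        replace (x + s * b - x) with (s * b) in Ew by ring; lra).
  eapply Rle_trans; [apply Rabs_triang|].
  rewrite !Rabs_mult, (Rabs_pos_eq s) by lra.
  assert (e = e / N * N) by (field; lra).
  set (k := e / N) in *.
  assert (Rabs a * Rabs (ft z (x + s * b) - ft t x) <= Rabs a * k)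
    by (apply Rmult_le_compat_l; lra).
  assert (Rabs b * Rabs (fx t w - fx t x) <= Rabs b * k)
    by (apply Rmult_le_compat_l; lra).
  unfold N in *; nra.
Qed.

Lemma small_step (a b x d : R) :
  a < b -> Icc a b x -> 0 < d ->
  exists y, Icc a b y /\ Rabs (y - x) < d /\ y <> x.
Proof.
  intros Hab Hx Hd; unfold Icc in *.
  set (m := Rmin d (b - a) / 2).
  assert (Hm : 0 < m /\ m < d /\ 2 * m <= b - a).
  { unfold m, Rmin; destruct (Rle_dec _ _); lra. }
  destruct (Rle_dec (x + m) b).
  - exists (x + m); replace (x + m - x) with m by ring.
    rewrite Rabs_pos_eq by lra; lra.
  - exists (x - m); replace (x - m - x) with (- m) by ring.
    rewrite Rabs_Ropp, Rabs_pos_eq by lra; lra.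
Qed.

(** Both mixed derivatives are limits of the same second difference quotient,
    taken over rectangles with a corner at the given point; this works with
    one-sided derivatives on the edges and at the corners. *)
Lemma schwarz_rect (T L : R) (f ft fx ftt ftx fxt fxx : R -> R -> R) :
  0 < T -> 0 < L -> C1_jet T L f ft fx -> C1_jet T L ft ftt ftx ->
  C1_jet T L fx fxt fxx ->
  forall t x, rect T L (t, x) -> fxt t x = ftx t x.
Proof.
  intros HT HL [H _] [Ht [_ [_ Ct]]] [Hx [_ [Cx _]]] t x Hp.
  apply NNPP; intros Hne.
  assert (He : 0 < Rabs (fxt t x - ftx t x) / 2).
  { apply Rdiv_lt_0_compat; [apply Rabs_pos_lt; lra|lra]. }
  set (e := Rabs (fxt t x - ftx t x) / 2) in *.
  destruct (cont_rect_eps T L ftx t x _ Ct Hp He) as [d1 Hd1].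
  destruct (cont_rect_eps T L fxt t x _ Cx Hp He) as [d2 Hd2].
  assert (Hd : 0 < Rmin d1 d2) by (apply Rmin_pos; apply cond_pos).
  pose proof (Rmin_l d1 d2); pose proof (Rmin_r d1 d2).
  unfold rect in *; simpl in *.
  destruct (small_step 0 T t _ HT (proj1 Hp) Hd) as [s [HsI [Hs Hst]]].
  destruct (small_step 0 L x _ HL (proj2 Hp) Hd) as [y [HyI [Hy Hyx]]].
  destruct (mean_value_on 0 T (fun z => f z y - f z x)
    (fun z => ft z y - ft z x) t s) as [z1 [Hz1 [Hz1' E1]]]; try tauto.
  { intros z Hz; apply is_derive_on_minus; apply H; tauto. }
  destruct (mean_value_on 0 L (fun w => ft z1 w) (fun w => ftx z1 w) x y)
    as [w1 [Hw1 [Hw1' F1]]]; try tauto.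
  { intros w Hw; apply Ht; tauto. }
  destruct (mean_value_on 0 L (fun w => f s w - f t w)
    (fun w => fx s w - fx t w) x y) as [w2 [Hw2 [Hw2' E2]]]; try tauto.
  { intros w Hw; apply is_derive_on_minus; apply H; tauto. }
  destruct (mean_value_on 0 T (fun z => fx z w2) (fun z => fxt z w2) t s)
    as [z2 [Hz2 [Hz2' F2]]]; try tauto.
  { intros z Hz; apply Hx; tauto. }
  pose proof (Rabs_between _ _ _ _ Hz1' Hs).
  pose proof (Rabs_between _ _ _ _ Hz2' Hs).
  pose proof (Rabs_between _ _ _ _ Hw1' Hy).
  pose proof (Rabs_between _ _ _ _ Hw2' Hy).
  specialize (Hd1 z1 w1 ltac:(tauto) ltac:(lra) ltac:(lra)).
  specialize (Hd2 z2 w2 ltac:(tauto) ltac:(lra) ltac:(lra)).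
  assert (Heq : ftx z1 w1 = fxt z2 w2).
  { rewrite F1 in E1; rewrite F2 in E2.
    apply Rmult_eq_reg_r with ((y - x) * (s - t)).
    - lra.
    - apply Rmult_integral_contrapositive_currified; lra. }
  assert (2 * e = Rabs (fxt t x - ftx t x)) by (unfold e; field).
  replace (fxt t x - ftx t x)
    with ((ftx z1 w1 - ftx t x) - (fxt z2 w2 - fxt t x)) in * by lra.
  pose proof (Rabs_triang (ftx z1 w1 - ftx t x) (- (fxt z2 w2 - fxt t x))) as Ht'.
  rewrite Rabs_Ropp in Ht'; unfold Rminus in *; lra.
Qed.

Definition jet_sub (J1 J2 : jet) : jet :=
  Jet (fun t x => val J1 t x - val J2 t x)
      (fun t x => d_t J1 t x - d_t J2 t x)
      (fun t x => d_x J1 t x - d_x J2 t x)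
      (fun t x => d_tt J1 t x - d_tt J2 t x)
      (fun t x => d_tx J1 t x - d_tx J2 t x)
      (fun t x => d_xx J1 t x - d_xx J2 t x).

Definition jet_shift (s : R) (J : jet) : jet :=
  Jet (fun t x => val J (t + s) x) (fun t x => d_t J (t + s) x)
      (fun t x => d_x J (t + s) x) (fun t x => d_tt J (t + s) x)
      (fun t x => d_tx J (t + s) x) (fun t x => d_xx J (t + s) x).

Definition jet_zero : jet :=
  let z := fun _ _ : R => 0 in Jet z z z z z z.

Lemma cont_rect_minus (T L : R) (f g : R -> R -> R) :
  cont_rect T L f -> cont_rect T L g ->
  cont_rect T L (fun t x => f t x - g t x).
Proof.
  intros Hf Hg; apply cont_rect_plus; [exact Hf|].
  apply (cont_rect_comp T L Ropp); [|exact Hg].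
  intros a; exact (@filterlim_opp _ R_NormedModule a).
Qed.

Lemma C1_jet_sub (T L : R) (f ft fx g gt gx : R -> R -> R) :
  C1_jet T L f ft fx -> C1_jet T L g gt gx ->
  C1_jet T L (fun t x => f t x - g t x) (fun t x => ft t x - gt t x)
    (fun t x => fx t x - gx t x).
Proof.
  intros [Hf [C1 [C2 C3]]] [Hg [D1 [D2 D3]]].
  split; [|split; [|split]]; try now apply cont_rect_minus.
  intros t x Hp; split; apply is_derive_on_minus; (apply Hf || apply Hg); exact Hp.
Qed.

Lemma C2_jet_sub (T L : R) (J1 J2 : jet) :
  C2_jet T L J1 -> C2_jet T L J2 -> C2_jet T L (jet_sub J1 J2).
Proof.
  intros [H1 [H2 H3]] [G1 [G2 G3]]; split; [|split]; now apply C1_jet_sub.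
Qed.

Lemma C2_jet_zero (T L : R) : C2_jet T L jet_zero.
Proof.
  assert (H : C1_jet T L (fun _ _ => 0) (fun _ _ => 0) (fun _ _ => 0)).
  { assert (Hc : cont_rect T L (fun _ _ => 0)) by (intros p _; apply filterlim_const).
    split; [|split; [|split]]; try exact Hc.
    intros t x _; split; apply is_derive_on_const. }
  split; [|split]; exact H.
Qed.

(** The translate lives on a shorter time interval, on which it is to be
    compared with the unshifted function: the case [s = 0] is that restriction. *)
Lemma C1_jet_shift (T T' L s : R) (f ft fx : R -> R -> R) :
  0 <= s -> T' + s <= T -> C1_jet T L f ft fx ->
  C1_jet T' L (fun t x => f (t + s) x) (fun t x => ft (t + s) x)
    (fun t x => fx (t + s) x).
Proof.
  intros Hs HT [H [C1 [C2 C3]]].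
  assert (Hr : forall t x, rect T' L (t, x) -> rect T L (t + s, x)).
  { unfold rect, Icc; simpl; intros; lra. }
  assert (Hc : forall g, cont_rect T L g ->
    cont_rect T' L (fun t x => g (t + s) x)).
  { intros g Hg [t x] Hp P HP.
    destruct (Hg (t + s, x) (Hr t x Hp) P HP) as [d Hd].
    exists d; intros [t' x'] [Ht' Hx'] Hp'.
    apply (Hd (t' + s, x')); [split|exact (Hr t' x' Hp')]; [|exact Hx'].
    change (Rabs (t' + s - (t + s)) < d).
    change (Rabs (t' - t) < d) in Ht'.
    now replace (t' + s - (t + s)) with (t' - t) by ring. }
  split; [|split; [|split]]; try now apply Hc.
  intros t x Hp; split.
  - apply (is_derive_on_shift 0 T' s (fun z => f z x)); [exact (proj1 Hp)|].
    apply is_derive_on_mono with 0 T; try lra.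
    + destruct Hp as [Hp _]; unfold Icc in *; simpl in *; lra.
    + exact (proj1 (H _ _ (Hr t x Hp))).
  - exact (proj2 (H _ _ (Hr t x Hp))).
Qed.

Lemma C2_jet_shift (T T' L s : R) (J : jet) :
  0 <= s -> T' + s <= T -> C2_jet T L J -> C2_jet T' L (jet_shift s J).
Proof.
  intros Hs HT [H1 [H2 H3]].
  split; [|split]; now apply (C1_jet_shift T T' L s).
Qed.

Definition jet_of (T L : R) (u : R -> R -> R) : jet :=
  Jet u (D_t T u) (Defs.D_x L u) (D_t T (D_t T u)) (Defs.D_x L (D_t T u))
    (Defs.D_x L (Defs.D_x L u)).

Lemma C1_rect_jet (T L : R) (u : R -> R -> R) :
  0 < T -> 0 < L -> C1_rect T L u -> C1_jet T L u (D_t T u) (Defs.D_x L u).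
Proof.
  intros HT HL [H [C1 [C2 C3]]]; split; [|split; [|split]]; try assumption.
  intros t x Hp; destruct (H t x Hp) as [Ht Hx].
  split; apply Derive_on_correct; try assumption; apply Hp.
Qed.

Lemma C1_jet_ext (T L : R) (f ft fx gt : R -> R -> R) :
  (forall t x, rect T L (t, x) -> ft t x = gt t x) ->
  C1_jet T L f ft fx -> C1_jet T L f gt fx.
Proof.
  intros E [H [C1 [C2 C3]]]; split; [|split; [|split]]; try assumption.
  - intros t x Hp; rewrite <- E by exact Hp; exact (H t x Hp).
  - intros [t x] Hp; simpl; rewrite <- (E t x Hp).
    intros P HP; destruct (C2 (t, x) Hp P HP) as [d Hd].
    exists d; intros [s y] Hb Hq; simpl.
    rewrite <- (E s y Hq); exact (Hd (s, y) Hb Hq).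
Qed.

Lemma C2_rect_jet (T L : R) (u : R -> R -> R) :
  0 < T -> 0 < L -> C2_rect T L u -> C2_jet T L (jet_of T L u).
Proof.
  intros HT HL [H1 [H2 H3]].
  apply C1_rect_jet in H1, H2, H3; try assumption.
  split; [exact H1|split; [exact H2|]]; simpl.
  apply C1_jet_ext with (D_t T (Defs.D_x L u)); [|exact H3].
  intros t x Hp; now apply (schwarz_rect T L u (D_t T u) (Defs.D_x L u)
    (D_t T (D_t T u)) _ _ (Defs.D_x L (Defs.D_x L u))).
Qed.

(** * A weighted maximum principle for Riemann invariants *)

(** The Riemann invariant of the family with slope [- l]; the other family is
    obtained with [- l] in place of [l]. *)
Definition riemann (l : R -> R -> R) (J : jet) (t x : R) : R :=
  d_t J t x + l t x * d_x J t x.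

Definition amp (l : R -> R -> R) (J : jet) (t x : R) : R :=
  Rmax (Rabs (val J t x))
    (Rmax (Rabs (riemann l J t x))
       (Rabs (riemann (fun t x => - l t x) J t x))).

(** In the direction [(1, - l)], with [l] frozen at its value at the point, the
    mixed derivatives in the derivative of [d_t + l * d_x] cancel and leave
    [d_tt - l ^ 2 * d_xx]. The variation of [l] multiplies [d_x], so that a
    Lipschitz speed is enough. *)
Lemma riemann_along (T L : R) (J : jet) (l : R -> R -> R)
    (Lam M t x sg s0 e : R) :
  C2_jet T L J -> 0 <= Lam -> lip_rect T L Lam l -> rect T L (t, x) ->
  Rabs (d_tt J t x - l t x * l t x * d_xx J t x) <= M ->
  Rabs sg = 1 -> 0 < s0 -> 0 < e ->
  (forall s, 0 < s < s0 -> rect T L (t + s * sg, x + s * - (sg * l t x))) ->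
  exists s1, 0 < s1 <= s0 /\ forall s, 0 < s < s1 ->
    Rabs (riemann l J (t + s * sg) (x + s * - (sg * l t x)) - riemann l J t x)
    <= s * (M + Lam * (1 + Rabs (l t x)) * Rabs (d_x J t x)) + e * s.
Proof.
  intros [_ [Ht Hx]] HLam Hlip Hp HM Hsg Hs0 He Hray.
  set (lam := l t x) in *.
  pose proof (Rabs_pos lam).
  set (e1 := e / (2 * (1 + Rabs lam))).
  assert (He1 : 0 < e1) by (apply Rdiv_lt_0_compat; lra).
  assert (He1' : e1 * (1 + Rabs lam) = e / 2) by (unfold e1; field; lra).
  destruct (C1_jet_directional T L _ _ _ t x sg (- (sg * lam)) s0 e1
    Ht Hp Hs0 He1 Hray) as [sa [Hsa Da]].
  destruct (C1_jet_directional T L _ _ _ t x sg (- (sg * lam)) s0 e1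
    Hx Hp Hs0 He1 Hray) as [sb [Hsb Db]].
  set (mt := sg * d_tt J t x + - (sg * lam) * d_tx J t x) in *.
  set (mx := sg * d_tx J t x + - (sg * lam) * d_xx J t x) in *.
  set (P := Lam * (1 + Rabs lam) * (Rabs mx + e1)).
  assert (HP : 0 <= P).
  { pose proof (Rabs_pos mx); unfold P; repeat apply Rmult_le_pos; lra. }
  set (sc := e / (2 * (P + 1))).
  assert (Hsc : 0 < sc) by (apply Rdiv_lt_0_compat; lra).
  assert (Hsc' : sc * (P + 1) = e / 2) by (unfold sc; field; lra).
  exists (Rmin (Rmin sa sb) sc).
  pose proof (Rmin_l (Rmin sa sb) sc); pose proof (Rmin_r (Rmin sa sb) sc).
  pose proof (Rmin_l sa sb); pose proof (Rmin_r sa sb).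
  split.
  { split; [repeat apply Rmin_pos; lra|lra]. }
  intros s Hs.
  specialize (Da s ltac:(lra)); specialize (Db s ltac:(lra)).
  pose proof (Hray s ltac:(lra)) as Hq.
  pose proof (Hlip t x _ _ Hp Hq) as Hl; fold lam in Hl.
  set (q1 := t + s * sg) in *; set (q2 := x + s * - (sg * lam)) in *.
  assert (Hdist : Rabs (q1 - t) + Rabs (q2 - x) = s * (1 + Rabs lam)).
  { replace (q1 - t) with (s * sg) by (unfold q1; ring).
    replace (q2 - x) with (s * (- (sg * lam))) by (unfold q2; ring).
    rewrite !Rabs_mult, Rabs_Ropp, Rabs_mult, Hsg, (Rabs_pos_eq s) by lra; ring. }
  rewrite Hdist in Hl.
  set (ra := d_t J q1 q2 - d_t J t x - s * mt) in *.
  set (rb := d_x J q1 q2 - d_x J t x - s * mx) in *.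
  set (w := d_tt J t x - lam * lam * d_xx J t x) in *.
  assert (Hdx : Rabs (d_x J q1 q2) <= Rabs (d_x J t x) + s * (Rabs mx + e1)).
  { replace (d_x J q1 q2) with (d_x J t x + (s * mx + rb)) by (unfold rb; ring).
    eapply Rle_trans; [apply Rabs_triang|].
    pose proof (Rabs_triang (s * mx) rb) as H5.
    rewrite Rabs_mult, (Rabs_pos_eq s) in H5 by lra; lra. }
  replace (riemann l J q1 q2 - riemann l J t x)
    with (s * (sg * w) + (ra + (lam * rb + (l q1 q2 - lam) * d_x J q1 q2)))
    by (unfold riemann, w, ra, rb, mt, mx; fold lam; ring).
  eapply Rle_trans; [apply Rabs_triang|].
  rewrite !Rabs_mult, Hsg, (Rabs_pos_eq s), Rmult_1_l by lra.
  pose proof (Rabs_triang ra (lam * rb + (l q1 q2 - lam) * d_x J q1 q2)) as T1.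
  pose proof (Rabs_triang (lam * rb) ((l q1 q2 - lam) * d_x J q1 q2)) as T2.
  rewrite !Rabs_mult in T2.
  assert (A1 : s * Rabs w <= s * M) by (apply Rmult_le_compat_l; lra).
  assert (A2 : Rabs lam * Rabs rb <= Rabs lam * (e1 * s))
    by (apply Rmult_le_compat_l; lra).
  assert (A3 : Rabs (l q1 q2 - lam) * Rabs (d_x J q1 q2) <=
    Lam * (s * (1 + Rabs lam)) * (Rabs (d_x J t x) + s * (Rabs mx + e1)))
    by (apply Rmult_le_compat; try apply Rabs_pos; assumption).
  assert (A4 : Lam * (s * (1 + Rabs lam)) *
      (Rabs (d_x J t x) + s * (Rabs mx + e1)) =
    s * (Lam * (1 + Rabs lam) * Rabs (d_x J t x)) + s * (s * P))
    by (unfold P; ring).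
  assert (A5 : s * (s * P) <= s * (e / 2)).
  { apply Rmult_le_compat_l; [lra|].
    apply Rle_trans with (sc * P); [apply Rmult_le_compat_r; lra|lra]. }
  assert (A6 : e1 * s + Rabs lam * (e1 * s) = s * (e / 2))
    by (rewrite <- He1'; ring).
  lra.
Qed.

(** Along a step of length [s] the weight gains the factor [exp (k * g * s)]
    while the amplitude loses at most the factor [1 - B * s], to first order. *)
Lemma exp_growth (m B g k : R) :
  0 < m -> 0 <= B -> B < k * g ->
  (forall e, 0 < e -> exists s1, 0 < s1 /\ forall s, 0 < s < s1 ->
     exp (k * (s * g)) * (m - s * (B * m) - e * s) <= m) -> False.
Proof.
  intros Hm HB Hk H.
  set (eta := k * g - B); assert (Heta : 0 < eta) by (unfold eta; lra).
  destruct (H (m * (eta / 2))) as [s1 [Hs1 Hs]].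
  { apply Rmult_lt_0_compat; lra. }
  set (D := B + eta).
  assert (HD : 0 < D) by (unfold D; lra).
  assert (Hx : 0 < eta / (4 * (D * D))).
  { apply Rdiv_lt_0_compat; [lra|]; nra. }
  set (y := eta / (4 * (D * D))) in *.
  assert (Hy : y * (4 * (D * D)) = eta) by (unfold y; field; lra).
  set (s := Rmin s1 y / 2).
  assert (Hs2 : 0 < s /\ s < s1 /\ s < y).
  { unfold s, Rmin; destruct (Rle_dec _ _); lra. }
  specialize (Hs s ltac:(lra)).
  assert (Hexp : 1 + s * D <= exp (k * (s * g))).
  { replace (k * (s * g)) with (s * D) by (unfold D, eta; ring).
    left; apply exp_ineq1; apply Rgt_not_eq, Rmult_lt_0_compat; lra. }
  assert (HsD : s * (D * D) <= eta / 4).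
  { apply Rle_trans with (y * (D * D)); [|lra].
    apply Rmult_le_compat_r; [nra|lra]. }
  assert (Hsmall : s * D < 1).
  { apply Rmult_lt_reg_r with D; [exact HD|]; unfold D in *; nra. }
  replace (m - s * (B * m) - m * (eta / 2) * s)
    with (m * (1 - s * (D - eta / 2))) in Hs by (unfold D; field).
  assert (H1 : (1 + s * D) * (m * (1 - s * (D - eta / 2))) <= m).
  { eapply Rle_trans; [|exact Hs].
    apply Rmult_le_compat_r; [|exact Hexp].
    apply Rmult_le_pos; [lra|]; nra. }
  assert (H2 : (1 + s * D) * (1 - s * (D - eta / 2)) <= 1).
  { apply Rmult_le_reg_l with m; [exact Hm|]; lra. }
  assert (H3 : s * (eta / 2 - s * (D * (D - eta / 2))) <= 0) by lra.
  assert (H4 : s * (D * (D - eta / 2)) <= s * (D * D)).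
  { apply Rmult_le_compat_l; [lra|]; nra. }
  nra.
Qed.

(** The invariants determine the gradient because the speed is bounded below:
    their sum is [2 * d_t] and their difference is [2 * l * d_x]. *)
Lemma amp_bounds (l : R -> R -> R) (J : jet) (c1 t x : R) :
  0 < c1 <= l t x ->
  Rabs (val J t x) <= amp l J t x /\ Rabs (d_t J t x) <= amp l J t x /\
  Rabs (d_x J t x) <= amp l J t x / c1.
Proof.
  intros Hl; unfold amp.
  set (a := Rabs (val J t x)).
  set (p := riemann l J t x); set (q := riemann (fun t x => - l t x) J t x).
  pose proof (Rmax_l a (Rmax (Rabs p) (Rabs q))).
  pose proof (Rmax_r a (Rmax (Rabs p) (Rabs q))).
  pose proof (Rmax_l (Rabs p) (Rabs q)); pose proof (Rmax_r (Rabs p) (Rabs q)).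
  set (m := Rmax a (Rmax (Rabs p) (Rabs q))) in *.
  assert (Hpq : p + q = 2 * d_t J t x /\ p - q = 2 * (l t x * d_x J t x))
    by (unfold p, q, riemann; split; ring).
  pose proof (Rabs_triang p q) as H3; pose proof (Rabs_triang p (- q)) as H4.
  change (p + - q) with (p - q) in H4.
  rewrite (proj1 Hpq) in H3; rewrite (proj2 Hpq), Rabs_Ropp in H4.
  rewrite Rabs_mult, (Rabs_pos_eq 2) in H3 by lra.
  rewrite !Rabs_mult, (Rabs_pos_eq 2), (Rabs_pos_eq (l t x)) in H4 by lra.
  split; [lra|split; [lra|]].
  apply Rmult_le_reg_r with c1; [lra|].
  unfold Rdiv; rewrite Rmult_assoc, Rinv_l, Rmult_1_r by lra.
  pose proof (Rabs_pos (d_x J t x)); nra.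
Qed.

Lemma amp_le (l : R -> R -> R) (J : jet) (c2 A t x : R) :
  0 <= l t x <= c2 -> Rabs (val J t x) <= A -> Rabs (d_t J t x) <= A ->
  Rabs (d_x J t x) <= A -> amp l J t x <= (1 + c2) * A.
Proof.
  intros Hl H1 H2 H3; pose proof (Rabs_pos (val J t x)).
  assert (Hm : Rabs (l t x * d_x J t x) <= c2 * A).
  { rewrite Rabs_mult, (Rabs_pos_eq (l t x)) by lra.
    apply Rmult_le_compat; try lra; apply Rabs_pos. }
  unfold amp, riemann.
  repeat apply Rmax_lub.
  - nra.
  - eapply Rle_trans; [apply Rabs_triang|]; lra.
  - replace (- l t x * d_x J t x) with (- (l t x * d_x J t x)) by ring.
    eapply Rle_trans; [apply Rabs_triang|]; rewrite Rabs_Ropp; lra.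
Qed.

Lemma amp_cont (T L Lam : R) (l : R -> R -> R) (J : jet) :
  0 <= Lam -> lip_rect T L Lam l -> C2_jet T L J -> cont_rect T L (amp l J).
Proof.
  intros HLam Hl [[_ [C0 [C1 C2]]] _].
  apply lip_rect_cont in Hl; [|exact HLam].
  assert (Habs : forall f, cont_rect T L f ->
    cont_rect T L (fun t x => Rabs (f t x))).
  { intros f; apply cont_rect_comp; exact continuous_Rabs. }
  assert (Hr : forall l', cont_rect T L l' -> cont_rect T L (riemann l' J)).
  { intros l' Hl'; apply cont_rect_plus; [exact C1|].
    apply cont_rect_mult; [exact Hl'|exact C2]. }
  apply cont_rect_max; [now apply Habs|].
  apply cont_rect_max; apply Habs, Hr; [exact Hl|].
  apply (cont_rect_comp T L Ropp); [|exact Hl].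
  intros a; exact (@filterlim_opp _ R_NormedModule a).
Qed.

Definition ray (Dom : R -> R -> Prop) (t x a b : R) : Prop :=
  exists s0, 0 < s0 /\ forall s, 0 < s < s0 -> Dom (t + s * a) (x + s * b).

(** A bound, relative to [amp], for the speed at which the three quantities in
    [amp] can vary: the source term and the variation of the speed for the
    invariants, the gradient for the function itself. *)
Definition rate (c1 c2 Lam M : R) : R :=
  M * (2 + / c1) + Lam * (1 + c2) / c1 + (1 + / c1).

Definition wave_ineq (T L M : R) (l : R -> R -> R) (J : jet) : Prop :=
  forall t x, rect T L (t, x) ->
    Rabs (d_tt J t x - l t x * l t x * d_xx J t x) <=
      M * (Rabs (val J t x) + Rabs (d_t J t x) + Rabs (d_x J t x)).

(** At [(t, x)] each of the three quantities in [amp] can be followed within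
    [Dom], forwards or backwards in time according to [sg], along its own
    characteristic direction (any direction [(a, b)] for the function itself),
    and the linear form [al * t + be * x] grows on the way. *)
Definition escapes (Dom : R -> R -> Prop) (l : R -> R -> R) (al be g t x : R)
    : Prop :=
  (exists sg, Rabs sg = 1 /\ ray Dom t x sg (- (sg * l t x)) /\
     g <= al * sg + be * - (sg * l t x)) /\
  (exists sg, Rabs sg = 1 /\ ray Dom t x sg (sg * l t x) /\
     g <= al * sg + be * (sg * l t x)) /\
  (exists a b, Rabs a <= 1 /\ Rabs b <= 1 /\ ray Dom t x a b /\
     g <= al * a + be * b).

(** At a maximum of [exp (k * (al * t + be * x)) * amp] one of the three
    quantities equals [amp]. If it can be followed in a direction in which the
    weight grows, a step along that direction increases the product, since [k]
    beats the rate of variation; hence the maximum is at a point where [amp] is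
    bounded by [A]. *)
Lemma weighted_maximum (T L : R) (J : jet) (l : R -> R -> R)
    (Lam M c1 c2 : R) (Dom : R -> R -> Prop) (al be g k A Psi : R) :
  C2_jet T L J -> 0 <= Lam -> lip_rect T L Lam l -> 0 <= M -> 0 < c1 ->
  (forall t x, rect T L (t, x) -> c1 <= l t x <= c2) ->
  wave_ineq T L M l J -> closed_in_rect T L Dom -> 0 <= A -> 0 < g ->
  rate c1 c2 Lam M < k * g ->
  (forall t x, Dom t x -> amp l J t x <= A \/ escapes Dom l al be g t x) ->
  (forall t x, Dom t x -> al * t + be * x <= Psi) ->
  forall t x, Dom t x ->
    exp (k * (al * t + be * x)) * amp l J t x <= exp (k * Psi) * A.
Proof.
  intros HJ HLam Hlip HM Hc1 Hl Hwave HO HA Hg Hk Hesc HPsi t0 x0 H0.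
  assert (Hc12 : c1 <= c2).
  { pose proof (Hl t0 x0 (proj1 HO _ _ H0)); lra. }
  assert (Hic : 0 < / c1) by now apply Rinv_0_lt_compat.
  assert (Hrate : 0 <= M * (2 + / c1) /\ 0 <= Lam * (1 + c2) / c1).
  { split; [|unfold Rdiv]; repeat apply Rmult_le_pos; lra. }
  assert (HB : 0 <= rate c1 c2 Lam M) by (unfold rate; lra).
  assert (Hkpos : 0 <= k).
  { apply Rmult_le_reg_r with g; lra. }
  set (f := fun t x => exp (k * (al * t + be * x)) * amp l J t x).
  destruct (max_attained T L Dom f HO) as [t [x [Hp Hmax]]].
  { apply cont_rect_mult; [|now apply amp_cont with Lam].
    apply (cont_rect_comp T L exp); [exact continuous_exp|].
    apply (cont_rect_comp T L (fun z => k * z)).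
    { intros a; apply (continuous_scal_r k (fun z : R => z)), continuous_id. }
    apply cont_rect_plus.
    - intros p _; eapply filterlim_filter_le_1; [apply filter_le_within|].
      apply (continuous_scal_r al (fun p : R * R => fst p)), continuous_fst.
    - intros p _; eapply filterlim_filter_le_1; [apply filter_le_within|].
      apply (continuous_scal_r be (fun p : R * R => snd p)), continuous_snd. }
  { now exists t0, x0. }
  eapply Rle_trans; [exact (Hmax t0 x0 H0)|]; unfold f in *; clear f.
  set (m := amp l J t x) in *.
  assert (Hm0 : 0 <= m).
  { apply Rle_trans with (Rabs (val J t x)); [apply Rabs_pos|apply Rmax_l]. }
  assert (Hexp : exp (k * (al * t + be * x)) <= exp (k * Psi)).
  { assert (Hle : k * (al * t + be * x) <= k * Psi)
      by (apply Rmult_le_compat_l; [exact Hkpos|now apply HPsi]).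
    destruct Hle as [Hlt| ->]; [left; now apply exp_increasing|right; reflexivity]. }
  destruct (Rle_or_lt m A) as [Hle|Hlt].
  { apply Rmult_le_compat; try assumption; left; apply exp_pos. }
  exfalso.
  destruct (Hesc t x Hp) as [Hle|
    [[s1 [Hs1 [R1 G1]]] [[s2 [Hs2 [R2 G2]]] [a [b [Ha [Hb [R3 G3]]]]]]]]; [fold m in Hle; lra|].
  pose proof (proj1 HO t x Hp) as Hrect.
  pose proof (Hl t x Hrect) as Hlp.
  destruct (amp_bounds l J c1 t x ltac:(lra)) as [Bv [Bt Bx]].
  fold m in Bv, Bt, Bx.
  assert (HraySub : forall a b, ray Dom t x a b -> exists s0, 0 < s0 /\
    forall s, 0 < s < s0 -> rect T L (t + s * a, x + s * b)).
  { intros a' b' [s0 [Hs0 Hr]]; exists s0; split; [exact Hs0|].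
    intros s Hs; apply HO; auto. }
  (* A component of the amplitude equal to [m] at the maximum cannot decrease
     along a ray as slowly as the rate allows. *)
  assert (Key : forall (rho : R -> R -> R) (a b : R),
    (forall t x, Rabs (rho t x) <= amp l J t x) -> Rabs (rho t x) = m ->
    ray Dom t x a b -> g <= al * a + be * b ->
    (forall e, 0 < e -> exists s1, 0 < s1 /\ forall s, 0 < s < s1 ->
       Rabs (rho (t + s * a) (x + s * b) - rho t x)
         <= s * (rate c1 c2 Lam M * m) + e * s) -> False).
  { intros rho a' b' Hrho Hrm [sr [Hsr Hr]] Hg' Hslow.
    apply (exp_growth m (rate c1 c2 Lam M) (al * a' + be * b') k); try lra.
    { apply Rlt_le_trans with (k * g); [exact Hk|].
      now apply Rmult_le_compat_l. }
    intros e He; destruct (Hslow e He) as [se [Hse Hd]].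
    exists (Rmin sr se); split; [now apply Rmin_pos|].
    intros s Hs; pose proof (Rmin_l sr se); pose proof (Rmin_r sr se).
    specialize (Hd s ltac:(lra)).
    pose proof (Hmax _ _ (Hr s ltac:(lra))) as Hq.
    set (t' := t + s * a') in *; set (x' := x + s * b') in *.
    replace (k * (al * t' + be * x')) with
      (k * (al * t + be * x) + k * (s * (al * a' + be * b'))) in Hq
      by (unfold t', x'; ring).
    rewrite exp_plus, Rmult_assoc in Hq.
    apply Rmult_le_reg_l in Hq; [|apply exp_pos].
    eapply Rle_trans; [|exact Hq].
    apply Rmult_le_compat_l; [left; apply exp_pos|].
    eapply Rle_trans; [|apply Hrho].
    replace (rho t x) with (rho t' x' - (rho t' x' - rho t x)) in Hrm by ring.
    pose proof (Rabs_triang (rho t' x') (- (rho t' x' - rho t x))) as Htr.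
    rewrite Rabs_Ropp in Htr; unfold Rminus at 1 in Hrm; lra. }
  assert (Hwave' : Rabs (d_tt J t x - l t x * l t x * d_xx J t x)
    <= M * (2 + / c1) * m).
  { eapply Rle_trans; [exact (Hwave t x Hrect)|].
    rewrite Rmult_assoc; apply Rmult_le_compat_l; [exact HM|].
    unfold Rdiv in Bx; lra. }
  (* Both Riemann invariants, [l' = l] and [l' = - l] at once. *)
  assert (Hinv : forall (l' : R -> R -> R) sg,
    lip_rect T L Lam l' -> l' t x * l' t x = l t x * l t x ->
    Rabs (l' t x) = l t x -> (forall t x, Rabs (riemann l' J t x) <= amp l J t x) ->
    Rabs (riemann l' J t x) = m -> Rabs sg = 1 ->
    ray Dom t x sg (- (sg * l' t x)) ->
    g <= al * sg + be * - (sg * l' t x) -> False).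
  { intros l' sg Hlip' Hsq Habs Hle Heq Hsg Hr Hg'.
    apply (Key (riemann l' J) sg (- (sg * l' t x))); try assumption.
    intros e He; destruct (HraySub _ _ Hr) as [s0 [Hs0 Hr']].
    rewrite <- Hsq in Hwave'.
    destruct (riemann_along T L J l' Lam (M * (2 + / c1) * m) t x sg s0 e)
      as [s' [Hs' Hd]]; try assumption.
    exists s'; split; [lra|]; intros s Hs; eapply Rle_trans; [exact (Hd s Hs)|].
    apply Rplus_le_compat_r, Rmult_le_compat_l; [lra|].
    rewrite Habs.
    assert (Hlast : Lam * (1 + l t x) * Rabs (d_x J t x)
      <= Lam * (1 + c2) * (m / c1)).
    { apply Rmult_le_compat; [apply Rmult_le_pos; lra|apply Rabs_pos| |exact Bx].
      apply Rmult_le_compat_l; lra. }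
    replace (rate c1 c2 Lam M * m) with (M * (2 + / c1) * m +
      Lam * (1 + c2) * (m / c1) + (1 + / c1) * m)
      by (unfold rate; field; lra).
    assert (0 <= (1 + / c1) * m) by (apply Rmult_le_pos; lra); lra. }
  assert (Hm : Rabs (val J t x) = m \/ Rabs (riemann l J t x) = m \/
    Rabs (riemann (fun t x => - l t x) J t x) = m).
  { unfold m, amp, Rmax; repeat destruct (Rle_dec _ _); auto. }
  destruct Hm as [Hm|[Hm|Hm]].
  - apply (Key (val J) a b); try assumption; [intros; apply Rmax_l|].
    intros e He; destruct (HraySub _ _ R3) as [s0 [Hs0 Hr']].
    destruct (C1_jet_directional T L _ _ _ t x a b s0 e (proj1 HJ) Hrect
      Hs0 He Hr') as [s' [Hs' Hd]].
    exists s'; split; [lra|]; intros s Hs; specialize (Hd s Hs).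
    set (dv := a * d_t J t x + b * d_x J t x) in *.
    replace (val J (t + s * a) (x + s * b) - val J t x) with
      (val J (t + s * a) (x + s * b) - val J t x - s * dv + s * dv) by ring.
    eapply Rle_trans; [apply Rabs_triang|].
    rewrite (Rabs_mult s), (Rabs_pos_eq s) by lra.
    assert (Hdv : Rabs dv <= (1 + / c1) * m).
    { unfold dv; eapply Rle_trans; [apply Rabs_triang|].
      rewrite !Rabs_mult.
      assert (Rabs a * Rabs (d_t J t x) <= 1 * m)
        by (apply Rmult_le_compat; try apply Rabs_pos; assumption).
      assert (Rabs b * Rabs (d_x J t x) <= 1 * (m / c1))
        by (apply Rmult_le_compat; try apply Rabs_pos; assumption).
      unfold Rdiv in *; lra. }
    assert (Hr : (1 + / c1) * m <= rate c1 c2 Lam M * m).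
    { apply Rmult_le_compat_r; [exact Hm0|unfold rate; lra]. }
    assert (s * Rabs dv <= s * (rate c1 c2 Lam M * m))
      by (apply Rmult_le_compat_l; lra).
    lra.
  - apply (Hinv l s1); try assumption; [reflexivity| |].
    + apply Rabs_pos_eq; lra.
    + intros; eapply Rle_trans; [apply Rmax_l|apply Rmax_r].
  - apply (Hinv (fun t x => - l t x) s2); try assumption.
    + intros t' x' s y Hp' Hq'; rewrite <- Rabs_Ropp.
      replace (- (- l s y - - l t' x')) with (l s y - l t' x') by ring.
      now apply Hlip.
    + ring.
    + rewrite Rabs_Ropp; apply Rabs_pos_eq; lra.
    + intros; eapply Rle_trans; [apply Rmax_r|apply Rmax_r].
    + now replace (- (s2 * - l t x)) with (s2 * l t x) by ring.
    + now replace (- (s2 * - l t x)) with (s2 * l t x) by ring.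
Qed.

Lemma closed_rect (T L : R) : closed_in_rect T L (fun t x => rect T L (t, x)).
Proof. split; [trivial|]; intros t x H H'; contradiction. Qed.

Lemma closed_half_plane (T L a b c : R) (Dom : R -> R -> Prop) :
  closed_in_rect T L Dom ->
  closed_in_rect T L (fun t x => Dom t x /\ a * t + b * x <= c).
Proof.
  intros [Hsub Hcl]; split; [intros t x [H _]; auto|].
  intros t x Hp Hn.
  destruct (classic (Dom t x)) as [HO|HO].
  - assert (Hlt : 0 < a * t + b * x - c).
    { destruct (Rle_or_lt (a * t + b * x) c); [|lra].
      exfalso; apply Hn; split; assumption. }
    set (n := Rabs a + Rabs b + 1).
    pose proof (Rabs_pos a); pose proof (Rabs_pos b).
    assert (Hd : 0 < (a * t + b * x - c) / n)
      by (apply Rdiv_lt_0_compat; unfold n; lra).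
    exists (mkposreal _ Hd); simpl; intros s y Hs Hy [_ Hle].
    set (d := (a * t + b * x - c) / n) in *.
    assert (E : d * n = a * t + b * x - c) by (unfold d; field; unfold n; lra).
    pose proof (Rabs_triang (a * (t - s)) (b * (x - y))) as Htr.
    rewrite !Rabs_mult, (Rabs_minus_sym t), (Rabs_minus_sym x) in Htr.
    pose proof (Rle_abs (a * (t - s) + b * (x - y))).
    assert (Rabs a * Rabs (s - t) <= Rabs a * d)
      by (apply Rmult_le_compat_l; lra).
    assert (Rabs b * Rabs (y - x) <= Rabs b * d)
      by (apply Rmult_le_compat_l; lra).
    unfold n in E; lra.
  - destruct (Hcl t x Hp HO) as [d Hd]; exists d.
    intros s y Hs Hy [H _]; exact (Hd s y Hs Hy H).
Qed.

(** * From lateral data to initial data *)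

Lemma exp_unweight (k z X m A : R) :
  exp (k * z) * m <= exp (k * X) * A -> m <= exp (k * (X - z)) * A.
Proof.
  intros H; apply Rmult_le_reg_l with (exp (k * z)); [apply exp_pos|].
  rewrite <- Rmult_assoc, <- exp_plus.
  now replace (k * z + k * (X - z)) with (k * X) by ring.
Qed.

Lemma exp_mono_le (x y A : R) : 0 <= A -> x <= y -> exp x * A <= exp y * A.
Proof.
  intros HA H; apply Rmult_le_compat_r; [exact HA|].
  destruct H as [H| ->]; [left; now apply exp_increasing|right; reflexivity].
Qed.

(** With [(o, e) = (1, 0)] or [(-1, L)], the variable [o * (x - e)] is the
    distance to the observed side, and the domain is the triangle of base
    [[0, T]] on that side with edges of slope [c1]. As [c1] is at most the speed
    of propagation, both characteristic directions pointing to the side stay in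
    the triangle. This solves the equation sidewise, with [x] as the evolution
    variable, and one characteristic family runs backwards in time. *)
Lemma triangle_estimate (T L : R) (J : jet) (l : R -> R -> R)
    (Lam M c1 c2 A k o e : R) :
  C2_jet T L J -> 0 <= Lam -> lip_rect T L Lam l -> 0 <= M -> 0 < c1 ->
  (forall t x, rect T L (t, x) -> c1 <= l t x <= c2) ->
  wave_ineq T L M l J -> 0 <= A -> 0 <= k ->
  rate c1 c2 Lam M < k * Rmin c1 1 ->
  o = 1 /\ e = 0 \/ o = -1 /\ e = L ->
  (forall t, Icc 0 T t -> amp l J t e <= A) ->
  forall t x, rect T L (t, x) -> o * (x - e) <= c1 * t ->
    o * (x - e) <= c1 * (T - t) -> amp l J t x <= exp (k * L) * A.
Proof.
  intros HJ HLam Hlip HM Hc1 Hl Hwave HA Hk Hkg Hoe Hside t0 x0 Hp0 H1 H2.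
  assert (Hg : 0 < Rmin c1 1) by (apply Rmin_pos; lra).
  pose proof (Rmin_l c1 1) as Hg1; pose proof (Rmin_r c1 1) as Hg2.
  assert (Ho : o * o = 1) by (destruct Hoe as [[-> _]|[-> _]]; ring).
  assert (Hoabs : Rabs o = 1).
  { unfold Rabs; destruct Hoe as [[-> _]|[-> _]], (Rcase_abs _); lra. }
  assert (Hz : forall x, Icc 0 L x <-> 0 <= o * (x - e) <= L).
  { intros x; unfold Icc; destruct Hoe as [[-> ->]|[-> ->]]; split; lra. }
  set (Dom := fun t x => (rect T L (t, x) /\ - c1 * t + o * x <= o * e) /\
      c1 * t + o * x <= c1 * T + o * e).
  assert (HO : Dom t0 x0) by (unfold Dom; split; [split; [exact Hp0|]|]; lra).
  pose proof (proj1 (Hz x0) (proj2 Hp0)) as Hz0.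
  eapply Rle_trans; [apply (exp_unweight k (0 * t0 + - o * x0) (- (o * e)))|].
  - apply (weighted_maximum T L J l Lam M c1 c2 Dom 0 (- o) (Rmin c1 1) k A
      (- (o * e))); try assumption.
    + apply closed_half_plane, closed_half_plane, closed_rect.
    + intros t x [[Hp Ha] Hb].
      pose proof (Hl t x Hp) as Hlx.
      pose proof (proj1 (Hz x) (proj2 Hp)) as Hzx.
      set (z := o * (x - e)) in *.
      destruct (Req_dec z 0) as [Hx|Hx].
      { left; replace x with e; [apply Hside, (proj1 Hp)|].
        unfold z in Hx; destruct Hoe as [[E _]|[E _]]; rewrite E in Hx; lra. }
      right.
      assert (Htt : 0 < t < T).
      { unfold z in *; split; apply Rmult_lt_reg_l with c1; lra. }
      set (r0 := Rmin (Rmin t (T - t)) (z / (c2 + 1))).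
      assert (Hs0 : 0 < r0).
      { repeat apply Rmin_pos; try lra; apply Rdiv_lt_0_compat; lra. }
      (* A step towards the side at speed at least [c1] stays in the triangle. *)
      assert (Hmem : forall s a b, 0 < s < r0 -> -1 <= a <= 1 ->
        0 <= b <= c2 + 1 -> c1 * a <= b -> - (c1 * a) <= b ->
        Dom (t + s * a) (x + s * - (o * b))).
      { intros s a b Hs Ha' Hb' Hab1 Hab2.
        pose proof (Rmin_l (Rmin t (T - t)) (z / (c2 + 1))) as M1.
        pose proof (Rmin_r (Rmin t (T - t)) (z / (c2 + 1))) as M2.
        pose proof (Rmin_l t (T - t)); pose proof (Rmin_r t (T - t)).
        fold r0 in M1, M2.
        assert (Hsc : s * (c2 + 1) < z).
        { replace z with (z / (c2 + 1) * (c2 + 1)) by (field; lra).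
          apply Rmult_lt_compat_r; lra. }
        assert (Sa : - s <= s * a <= s) by (split; nra).
        assert (Sb : 0 <= s * b <= s * (c2 + 1))
          by (split; [apply Rmult_le_pos|apply Rmult_le_compat_l]; lra).
        assert (S1 : s * (c1 * a) <= s * b) by (apply Rmult_le_compat_l; lra).
        assert (S2 : s * - (c1 * a) <= s * b) by (apply Rmult_le_compat_l; lra).
        assert (E : o * (x + s * - (o * b)) = o * x - s * b).
        { replace (o * (x + s * - (o * b))) with (o * x - o * o * (s * b)) by ring.
          rewrite Ho; ring. }
        unfold z in *.
        unfold Dom; rewrite E; split; [split|]; [split| |]; try lra.
        - unfold Icc; simpl; lra.
        - apply Hz; simpl.
          replace (o * (x + s * - (o * b) - e))
            with (o * (x + s * - (o * b)) - o * e) by ring.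
          rewrite E; lra. }
      split; [|split].
      * exists o; split; [exact Hoabs|split].
        -- exists r0; split; [exact Hs0|]; intros s Hs.
           apply Hmem; try lra; destruct Hoe as [[-> _]|[-> _]]; lra.
        -- replace (0 * o + - o * - (o * l t x)) with (o * o * l t x) by ring.
           rewrite Ho; lra.
      * exists (- o); split; [now rewrite Rabs_Ropp|split].
        -- exists r0; split; [exact Hs0|]; intros s Hs.
           replace (- o * l t x) with (- (o * l t x)) by ring.
           apply Hmem; try lra; destruct Hoe as [[-> _]|[-> _]]; lra.
        -- replace (0 * - o + - o * (- o * l t x)) with (o * o * l t x) by ring.
           rewrite Ho; lra.
      * exists 0, (- (o * 1)); split; [rewrite Rabs_R0; lra|].
        split; [rewrite Rmult_1_r, Rabs_Ropp; lra|split; [|lra]].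
        exists r0; split; [exact Hs0|]; intros s Hs; apply Hmem; lra.
    + intros t x [[[_ Hx] _] _]; apply Hz in Hx; simpl in Hx; lra.
  - apply exp_mono_le; [exact HA|]; apply Rmult_le_compat_l; [exact Hk|lra].
Qed.

(** As [L <= c1 * T], the two triangles together cover the segment
    [t = T / 2]. Below that segment both families are followed forwards in time
    until they meet it or one of the sides. *)
Lemma lateral_to_initial (L T0 c1 c2 Lam M : R) :
  0 < L -> 0 < T0 -> 0 < c1 <= c2 -> 0 <= Lam -> 0 <= M ->
  exists C, 0 < C /\ forall T J l A,
    L <= c1 * T -> T <= T0 -> C2_jet T L J -> lip_rect T L Lam l ->
    (forall t x, rect T L (t, x) -> c1 <= l t x <= c2) ->
    wave_ineq T L M l J -> 0 <= A ->
    (forall t x, Icc 0 T t -> x = 0 \/ x = L ->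
       Rabs (val J t x) <= A /\ Rabs (d_t J t x) <= A /\ Rabs (d_x J t x) <= A) ->
    forall x, Icc 0 L x -> amp l J 0 x <= C * A.
Proof.
  intros HL HT0 Hc HLam HM.
  set (g := Rmin c1 1).
  assert (Hg : 0 < g) by (apply Rmin_pos; lra).
  assert (Hg1 : g <= c1) by apply Rmin_l.
  assert (Hg2 : g <= 1) by apply Rmin_r.
  assert (Hic : 0 < / c1) by (apply Rinv_0_lt_compat; lra).
  assert (HB : 0 <= rate c1 c2 Lam M).
  { assert (0 <= M * (2 + / c1) /\ 0 <= Lam * (1 + c2) / c1).
    { split; [|unfold Rdiv]; repeat apply Rmult_le_pos; lra. }
    unfold rate; lra. }
  set (k := (rate c1 c2 Lam M + 1) / g).
  assert (Hkg : rate c1 c2 Lam M < k * g).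
  { replace (k * g) with (rate c1 c2 Lam M + 1) by (unfold k; field; lra); lra. }
  assert (Hk : 0 <= k) by (apply Rmult_le_reg_r with g; lra).
  exists (exp (k * T0) * (exp (k * L) * (1 + c2))); split.
  { repeat apply Rmult_lt_0_compat; try apply exp_pos; lra. }
  intros T J l A HLT HTT0 HJ Hlip Hl Hwave HA Hlat.
  assert (HT : 0 < T) by (apply Rmult_lt_reg_l with c1; lra).
  set (A1 := (1 + c2) * A).
  assert (HA1 : 0 <= A1) by (apply Rmult_le_pos; lra).
  assert (Hside : forall t x, rect T L (t, x) -> x = 0 \/ x = L ->
    amp l J t x <= A1).
  { intros t x Hp Hx; destruct (Hlat t x (proj1 Hp) Hx) as [H1 [H2 H3]].
    pose proof (Hl t x Hp).
    apply amp_le; try assumption; lra. }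
  set (A2 := exp (k * L) * A1).
  assert (HA2 : 0 <= A2) by (apply Rmult_le_pos; [left; apply exp_pos|exact HA1]).
  assert (HA12 : A1 <= A2).
  { replace A1 with (exp (k * 0) * A1) by (rewrite Rmult_0_r, exp_0; ring).
    apply exp_mono_le; [exact HA1|]; apply Rmult_le_compat_l; lra. }
  assert (Hleft : forall t x, rect T L (t, x) -> x <= c1 * t ->
    x <= c1 * (T - t) -> amp l J t x <= A2).
  { intros t x Hp H1 H2.
    apply (triangle_estimate T L J l Lam M c1 c2 A1 k 1 0); try assumption; try lra.
    intros t' Ht'; apply Hside; [|auto]; unfold rect, Icc in *; simpl in *; lra. }
  assert (Hright : forall t x, rect T L (t, x) -> L - x <= c1 * t ->
    L - x <= c1 * (T - t) -> amp l J t x <= A2).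
  { intros t x Hp H1 H2.
    apply (triangle_estimate T L J l Lam M c1 c2 A1 k (-1) L); try assumption; try lra.
    intros t' Ht'; apply Hside; [|auto]; unfold rect, Icc in *; simpl in *; lra. }
  (* Backwards in time from [T / 2], where the two triangles meet. *)
  intros x0 Hx0.
  set (Dom := fun t x => rect T L (t, x) /\ 1 * t + 0 * x <= T / 2).
  assert (HO : Dom 0 x0).
  { unfold Dom, rect, Icc in *; simpl; lra. }
  replace (exp (k * T0) * (exp (k * L) * (1 + c2)) * A)
    with (exp (k * T0) * A2) by (unfold A2, A1; ring).
  eapply Rle_trans; [apply (exp_unweight k (1 * 0 + 0 * x0) (T / 2))|].
  - apply (weighted_maximum T L J l Lam M c1 c2 Dom 1 0 g k A2 (T / 2));
      try assumption; try lra.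
    + apply closed_half_plane, closed_rect.
    + intros t x [Hp Ht].
      pose proof (Hl t x Hp) as Hlx.
      destruct (classic (x = 0 \/ x = L)) as [Hx|Hx].
      { left; pose proof (Hside t x Hp Hx); lra. }
      assert (Hpx : 0 < x < L).
      { destruct Hp as [_ Hp]; unfold Icc in Hp; simpl in Hp.
        destruct (Req_dec x 0), (Req_dec x L); tauto || lra. }
      destruct (Req_dec t (T / 2)) as [HtT|HtT].
      { left; destruct (Rle_or_lt x (L / 2)).
        - apply Hleft; [exact Hp|rewrite HtT; lra|rewrite HtT; lra].
        - apply Hright; [exact Hp|rewrite HtT; lra|rewrite HtT; lra]. }
      right.
      set (r0 := Rmin (T / 2 - t) (Rmin x (L - x) / (c2 + 1))).
      assert (Hmn : 0 < Rmin x (L - x)) by (apply Rmin_pos; lra).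
      assert (Hs0 : 0 < r0).
      { apply Rmin_pos; [lra|]; apply Rdiv_lt_0_compat; lra. }
      assert (Hmem : forall s b, 0 < s < r0 -> - c2 <= b <= c2 ->
        Dom (t + s * 1) (x + s * b)).
      { intros s b Hs Hb.
        pose proof (Rmin_l (T / 2 - t) (Rmin x (L - x) / (c2 + 1))) as M1.
        pose proof (Rmin_r (T / 2 - t) (Rmin x (L - x) / (c2 + 1))) as M2.
        pose proof (Rmin_l x (L - x)); pose proof (Rmin_r x (L - x)).
        fold r0 in M1, M2.
        assert (Hsc : s * (c2 + 1) < Rmin x (L - x)).
        { replace (Rmin x (L - x)) with (Rmin x (L - x) / (c2 + 1) * (c2 + 1))
            by (field; lra).
          apply Rmult_lt_compat_r; lra. }
        assert (Hsb : - (s * (c2 + 1)) <= s * b <= s * (c2 + 1)) by (split; nra).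
        destruct Hp as [Hpt Hpx']; unfold Dom, rect, Icc in *; simpl in *; lra. }
      split; [|split].
      * exists 1; split; [apply Rabs_R1|split; [|lra]].
        exists r0; split; [exact Hs0|]; intros s Hs; apply Hmem; [exact Hs|lra].
      * exists 1; split; [apply Rabs_R1|split; [|lra]].
        exists r0; split; [exact Hs0|]; intros s Hs; apply Hmem; [exact Hs|lra].
      * exists 1, 0; split; [rewrite Rabs_R1; lra|].
        split; [rewrite Rabs_R0; lra|split; [|lra]].
        exists r0; split; [exact Hs0|]; intros s Hs; apply Hmem; [exact Hs|lra].
    + intros t x [_ Ht]; exact Ht.
  - apply exp_mono_le; [exact HA2|]; apply Rmult_le_compat_l; lra.
Qed.

(** * The coefficients near the origin *)

Definition K_u (K : R -> R -> R) (a b : R) : R := Derive (fun z => K z b) a.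

Lemma mean_value_derive (r : R) (f : R -> R) (x y : R) :
  (forall z, Rabs z < r -> ex_derive f z) -> Rabs x < r -> Rabs y < r ->
  exists z, Rabs z < r /\ Rabs (z - x) <= Rabs (y - x) /\
    f y - f x = Derive f z * (y - x).
Proof.
  intros H Hx Hy.
  apply Rabs_def2 in Hx; apply Rabs_def2 in Hy.
  assert (HI : forall z, Rmin x y <= z <= Rmax x y -> Rabs z < r).
  { intros z Hz; unfold Rmin, Rmax in Hz; destruct (Rle_dec x y);
      apply Rabs_def1; lra. }
  destruct (MVT_gen f x y (Derive f)) as [z [Hz E]].
  - intros z Hz; apply Derive_correct, H, HI; lra.
  - intros z Hz; apply continuity_pt_filterlim.
    exact (ex_derive_continuous f z (H z (HI z Hz))).
  - exists z; split; [now apply HI|split; [|exact E]].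
    unfold Rmin, Rmax in Hz; destruct (Rle_dec x y).
    + rewrite !Rabs_pos_eq; lra.
    + rewrite (Rabs_minus_sym z), (Rabs_minus_sym y), !Rabs_pos_eq; lra.
Qed.

Lemma lipschitz_derive (r B : R) (f : R -> R) (x y : R) :
  (forall z, Rabs z < r -> ex_derive f z /\ Rabs (Derive f z) <= B) ->
  Rabs x < r -> Rabs y < r -> Rabs (f y - f x) <= B * Rabs (y - x).
Proof.
  intros H Hx Hy.
  destruct (mean_value_derive r f x y) as [z [Hz [_ E]]]; try assumption.
  { intros z Hz; now apply H. }
  rewrite E, Rabs_mult; apply Rmult_le_compat_r; [apply Rabs_pos|].
  now apply H.
Qed.

Definition lip2 (r B : R) (g : R -> R -> R) : Prop :=
  forall a b a' b', Rabs a < r -> Rabs b < r -> Rabs a' < r -> Rabs b' < r ->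
    Rabs (g a' b' - g a b) <= B * (Rabs (a' - a) + Rabs (b' - b)).

Definition lip3 (r B : R) (g : R -> R -> R -> R) : Prop :=
  forall a b c a' b' c', Rabs a < r -> Rabs b < r -> Rabs c < r ->
    Rabs a' < r -> Rabs b' < r -> Rabs c' < r ->
    Rabs (g a' b' c' - g a b c)
      <= B * (Rabs (a' - a) + Rabs (b' - b) + Rabs (c' - c)).

Lemma continuity_2d_bounded (g : R -> R -> R) :
  continuity_2d_pt g 0 0 -> exists d : posreal, forall a b,
    Rabs a < d -> Rabs b < d -> Rabs (g a b) <= Rabs (g 0 0) + 1.
Proof.
  intros H; destruct (H (mkposreal 1 Rlt_0_1)) as [d Hd]; exists d.
  intros a b Ha Hb; specialize (Hd a b); rewrite !Rminus_0_r in Hd.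
  specialize (Hd Ha Hb); simpl in Hd.
  replace (g a b) with (g 0 0 + (g a b - g 0 0)) by ring.
  eapply Rle_trans; [apply Rabs_triang|lra].
Qed.

Lemma ex_diff_1_lip2 (r : R) (g : R -> R -> R) :
  0 < r -> (forall a b, Rabs a < r -> Rabs b < r -> ex_diff_n g 1 a b) ->
  exists r' B, 0 < r' <= r /\ 0 <= B /\ lip2 r' B g.
Proof.
  intros Hr H.
  assert (H0 : Rabs 0 < r) by now rewrite Rabs_R0.
  destruct (H 0 0 H0 H0) as [_ [_ [_ [[Ca _] [Cb _]]]]].
  destruct (continuity_2d_bounded _ Ca) as [da Ha].
  destruct (continuity_2d_bounded _ Cb) as [db Hb].
  set (Ba := Rabs (Derive (fun z => g z 0) 0) + 1) in *.
  set (Bb := Rabs (Derive (fun z => g 0 z) 0) + 1) in *.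
  set (r' := Rmin r (Rmin da db)).
  assert (Hr' : r' <= r /\ r' <= da /\ r' <= db).
  { pose proof (Rmin_l r (Rmin da db)); pose proof (Rmin_r r (Rmin da db)).
    pose proof (Rmin_l da db); pose proof (Rmin_r da db); unfold r'; lra. }
  assert (Hpos : 0 <= Ba /\ 0 <= Bb).
  { pose proof (Rabs_pos (Derive (fun z => g z 0) 0)).
    pose proof (Rabs_pos (Derive (fun z => g 0 z) 0)); unfold Ba, Bb; lra. }
  exists r', (Ba + Bb); split; [split; [|apply Hr']|split; [lra|]].
  { repeat apply Rmin_pos; try apply cond_pos; exact Hr. }
  intros a b a' b' Ga Gb Ga' Gb'.
  replace (g a' b' - g a b) with ((g a' b' - g a b') + (g a b' - g a b)) by ring.
  eapply Rle_trans; [apply Rabs_triang|].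
  rewrite Rmult_plus_distr_l; apply Rplus_le_compat.
  - apply (lipschitz_derive r' (Ba + Bb) (fun z => g z b')); try assumption.
    intros z Hz; split; [apply (H z b'); lra|].
    eapply Rle_trans; [apply (Ha z b'); lra|lra].
  - apply (lipschitz_derive r' (Ba + Bb) (fun z => g a z)); try assumption.
    intros z Hz; split; [apply (H a z); lra|].
    eapply Rle_trans; [apply (Hb a z); lra|lra].
Qed.

Lemma continuous_on_box3_bounded (r : R) (g : R * R * R -> R) :
  0 < r -> continuous_on (box3 r) g ->
  exists d B, 0 < d <= r /\ 0 <= B /\ forall a b c,
    Rabs a < d -> Rabs b < d -> Rabs c < d -> Rabs (g (a, b, c)) <= B.
Proof.
  intros Hr H.
  assert (H0 : box3 r (0, 0, 0)) by (unfold box3; simpl; now rewrite !Rabs_R0).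
  destruct (proj1 (filterlim_locally _ _) (H (0, 0, 0) H0) (mkposreal 1 Rlt_0_1))
    as [d Hd].
  pose proof (Rmin_l d r) as Hm1; pose proof (Rmin_r d r) as Hm2.
  exists (Rmin d r), (Rabs (g (0, 0, 0)) + 1); split; [|split].
  { split; [apply Rmin_pos; [apply cond_pos|exact Hr]|apply Rmin_r]. }
  { pose proof (Rabs_pos (g (0, 0, 0))); lra. }
  intros a b c Ha Hb Hc.
  assert (Hball : forall z, Rabs z < Rmin d r -> ball (0 : R) d z).
  { intros z Hz; change (Rabs (z - 0) < d); rewrite Rminus_0_r; lra. }
  assert (Hg : Rabs (g (a, b, c) - g (0, 0, 0)) < 1).
  { apply (Hd (a, b, c)).
    - split; [split|]; apply Hball; assumption.
    - unfold box3; simpl; lra. }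
  replace (g (a, b, c)) with (g (0, 0, 0) + (g (a, b, c) - g (0, 0, 0))) by ring.
  eapply Rle_trans; [apply Rabs_triang|lra].
Qed.

Lemma C1_near0_lip3 (r : R) (F : R -> R -> R -> R) :
  0 < r -> C1_near0 r F -> exists r' B, 0 < r' <= r /\ 0 <= B /\ lip3 r' B F.
Proof.
  intros Hr [Hex [_ [Ca [Cb Cc]]]].
  destruct (continuous_on_box3_bounded _ _ Hr Ca) as [da [Ba [Hda [HBa Ha]]]].
  destruct (continuous_on_box3_bounded _ _ Hr Cb) as [db [Bb [Hdb [HBb Hb]]]].
  destruct (continuous_on_box3_bounded _ _ Hr Cc) as [dc [Bc [Hdc [HBc Hc]]]].
  set (r' := Rmin da (Rmin db dc)).
  assert (Hr' : r' <= da /\ r' <= db /\ r' <= dc).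
  { pose proof (Rmin_l da (Rmin db dc)); pose proof (Rmin_r da (Rmin db dc)).
    pose proof (Rmin_l db dc); pose proof (Rmin_r db dc); unfold r'; lra. }
  exists r', (Ba + Bb + Bc); split; [split; [|lra]|split; [lra|]].
  { repeat apply Rmin_pos; lra. }
  intros a b c a' b' c' Ga Gb Gc Ga' Gb' Gc'.
  replace (F a' b' c' - F a b c) with ((F a' b' c' - F a b' c') +
    (F a b' c' - F a b c') + (F a b c' - F a b c)) by ring.
  eapply Rle_trans; [apply Rabs_triang|].
  rewrite !Rmult_plus_distr_l; apply Rplus_le_compat.
  1: eapply Rle_trans; [apply Rabs_triang|]; apply Rplus_le_compat.
  - apply (lipschitz_derive r' _ (fun z => F z b' c')); try assumption.
    intros z Hz; split; [apply (Hex z b' c'); unfold box3; simpl; lra|].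
    eapply Rle_trans; [apply (Ha z b' c'); lra|lra].
  - apply (lipschitz_derive r' _ (fun z => F a z c')); try assumption.
    intros z Hz; split; [apply (Hex a z c'); unfold box3; simpl; lra|].
    eapply Rle_trans; [apply (Hb a z c'); lra|lra].
  - apply (lipschitz_derive r' _ (fun z => F a b z)); try assumption.
    intros z Hz; split; [apply (Hex a b z); unfold box3; simpl; lra|].
    eapply Rle_trans; [apply (Hc a b z); lra|lra].
Qed.

(** What is used of the coefficients, on a cube around the origin; [c1] and [c2]
    bound the speed of propagation. *)
Record tame (K : R -> R -> R) (F : R -> R -> R -> R) (r B c1 c2 : R) : Prop := {
  tame_r : 0 < r;
  tame_B : 0 <= B;
  tame_c : 0 < c1 <= c2;
  tame_diff : forall a b, Rabs a < r -> Rabs b < r ->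
    ex_derive (fun z => K z b) a /\ ex_derive (fun z => K a z) b;
  tame_Ku : lip2 r B (K_u K);
  tame_Kv : lip2 r B (K_v K);
  tame_Ku_le : forall a b, Rabs a < r -> Rabs b < r -> Rabs (K_u K a b) <= B;
  tame_Kv_le : forall a b, Rabs a < r -> Rabs b < r ->
    c1 * c1 <= K_v K a b <= c2 * c2;
  tame_F : lip3 r B F }.

Lemma lip2_weaken (r r' B B' : R) (g : R -> R -> R) :
  r' <= r -> B <= B' -> lip2 r B g -> lip2 r' B' g.
Proof.
  intros Hr HB H a b a' b' Ha Hb Ha' Hb'.
  eapply Rle_trans; [apply H; lra|]; apply Rmult_le_compat_r; [|exact HB].
  pose proof (Rabs_pos (a' - a)); pose proof (Rabs_pos (b' - b)); lra.
Qed.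

Lemma lip3_weaken (r r' B B' : R) (g : R -> R -> R -> R) :
  r' <= r -> B <= B' -> lip3 r B g -> lip3 r' B' g.
Proof.
  intros Hr HB H a b c a' b' c' Ha Hb Hc Ha' Hb' Hc'.
  eapply Rle_trans; [apply H; lra|]; apply Rmult_le_compat_r; [|exact HB].
  pose proof (Rabs_pos (a' - a)); pose proof (Rabs_pos (b' - b)).
  pose proof (Rabs_pos (c' - c)); lra.
Qed.

(** [c1] may be any number below the speed at the origin, as the coefficients
    are only considered close to it. *)
Lemma tame_near0 (r c1 : R) (K : R -> R -> R) (F : R -> R -> R -> R) :
  0 < r -> C2_near0 r K -> C1_near0 r F -> 0 < c1 < sqrt (K_v K 0 0) ->
  exists r' B c2, tame K F r' B c1 c2.
Proof.
  intros Hr HK HF Hc.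
  assert (H0 : forall d, 0 < d -> Rabs 0 < d) by (intros; now rewrite Rabs_R0).
  destruct (ex_diff_1_lip2 r (K_u K) Hr) as [ru [Bu [Hru [HBu Lu]]]].
  { intros a b Ha Hb; apply (HK a b Ha Hb). }
  destruct (ex_diff_1_lip2 r (K_v K) Hr) as [rv [Bv [Hrv [HBv Lv]]]].
  { intros a b Ha Hb; apply (HK a b Ha Hb). }
  destruct (C1_near0_lip3 r F Hr HF) as [rF [BF [HrF [HBF LF]]]].
  destruct (HK 0 0 (H0 r Hr) (H0 r Hr)) as [_ [_ [_ [[Cu _] [Cv _]]]]].
  destruct (continuity_2d_bounded _ Cu) as [du Hdu].
  set (c := sqrt (K_v K 0 0)) in *.
  assert (Hsq : c * c = K_v K 0 0).
  { apply sqrt_sqrt; destruct (Rle_or_lt 0 (K_v K 0 0)) as [|Hneg]; [assumption|].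
    assert (c = 0) by (apply sqrt_neg_0; lra); lra. }
  assert (He : 0 < c * c - c1 * c1) by nra.
  destruct (Cv (mkposreal _ He)) as [dv Hdv]; simpl in Hdv.
  set (r' := Rmin (Rmin ru rv) (Rmin rF (Rmin du dv))).
  assert (Hr' : r' <= ru /\ r' <= rv /\ r' <= rF /\ r' <= du /\ r' <= dv).
  { pose proof (Rmin_l (Rmin ru rv) (Rmin rF (Rmin du dv))).
    pose proof (Rmin_r (Rmin ru rv) (Rmin rF (Rmin du dv))).
    pose proof (Rmin_l ru rv); pose proof (Rmin_r ru rv).
    pose proof (Rmin_l rF (Rmin du dv)); pose proof (Rmin_r rF (Rmin du dv)).
    pose proof (Rmin_l du dv); pose proof (Rmin_r du dv); unfold r'; lra. }
  pose proof (Rabs_pos (Derive (fun z => K z 0) 0)).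
  exists r', (Bu + Bv + BF + (Rabs (Derive (fun z => K z 0) 0) + 1)), (2 * c).
  split.
  - repeat apply Rmin_pos; try apply cond_pos; lra.
  - lra.
  - lra.
  - intros a b Ha Hb; split; apply (HK a b); lra.
  - apply lip2_weaken with ru Bu; [lra|lra|exact Lu].
  - apply lip2_weaken with rv Bv; [lra|lra|exact Lv].
  - intros a b Ha Hb; eapply Rle_trans; [apply (Hdu a b); lra|lra].
  - intros a b Ha Hb; specialize (Hdv a b); rewrite !Rminus_0_r in Hdv.
    specialize (Hdv ltac:(lra) ltac:(lra)).
    change (Rabs (K_v K a b - K_v K 0 0) < c * c - c1 * c1) in Hdv.
    apply Rabs_def2 in Hdv; rewrite <- Hsq in Hdv; nra.
  - apply lip3_weaken with rF BF; [lra|lra|exact LF].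
Qed.

(** Since the partial derivatives of [K] are Lipschitz, the mean value theorem
    in each variable gives a second-order remainder. *)
Lemma chain_rule_on (a b r B : R) (K : R -> R -> R) (f g : R -> R)
    (x f' g' : R) :
  (forall a b, Rabs a < r -> Rabs b < r ->
    ex_derive (fun z => K z b) a /\ ex_derive (fun z => K a z) b) ->
  0 <= B -> lip2 r B (K_u K) -> lip2 r B (K_v K) -> Icc a b x ->
  (forall y, Icc a b y -> Rabs (f y) < r /\ Rabs (g y) < r) ->
  is_derive_on a b f x f' -> is_derive_on a b g x g' ->
  is_derive_on a b (fun y => K (f y) (g y)) x
    (K_u K (f x) (g x) * f' + K_v K (f x) (g x) * g').
Proof.
  intros HK HB Lu Lv Hx Hbd Hf Hg; apply is_derive_on_eps; [exact Hx|].
  intros eps; pose proof (cond_pos eps) as He.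
  destruct (is_derive_on_lip _ _ _ _ _ Hx Hf) as [d1 L1].
  destruct (is_derive_on_lip _ _ _ _ _ Hx Hg) as [d2 L2].
  set (ku := K_u K (f x) (g x)); set (kv := K_v K (f x) (g x)).
  set (N := Rabs f' + 1 + (Rabs g' + 1)) in *.
  assert (HN : 0 < N) by (unfold N; pose proof (Rabs_pos f'); pose proof (Rabs_pos g'); lra).
  set (P := Rabs ku + Rabs kv + 1).
  assert (HP : 0 < P) by (unfold P; pose proof (Rabs_pos ku); pose proof (Rabs_pos kv); lra).
  assert (He1 : 0 < eps / (2 * P)) by (apply Rdiv_lt_0_compat; lra).
  destruct (proj1 (is_derive_on_eps _ _ _ _ _ Hx) Hf (mkposreal _ He1)) as [d3 E1].
  destruct (proj1 (is_derive_on_eps _ _ _ _ _ Hx) Hg (mkposreal _ He1)) as [d4 E2].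
  simpl in E1, E2.
  assert (HQ : 0 < 2 * (B * (N * N) + 1)).
  { assert (0 <= B * (N * N)) by (repeat apply Rmult_le_pos; lra); lra. }
  assert (He2 : 0 < eps / (2 * (B * (N * N) + 1))) by (apply Rdiv_lt_0_compat; lra).
  set (d := Rmin (Rmin (Rmin d1 d2) (Rmin d3 d4)) (eps / (2 * (B * (N * N) + 1)))).
  assert (Hd : 0 < d) by (repeat apply Rmin_pos; try apply cond_pos; lra).
  assert (Hdle : d <= d1 /\ d <= d2 /\ d <= d3 /\ d <= d4 /\
    d <= eps / (2 * (B * (N * N) + 1))).
  { unfold d; pose proof (Rmin_l (Rmin (Rmin d1 d2) (Rmin d3 d4)) (eps / (2 * (B * (N * N) + 1)))).
    pose proof (Rmin_r (Rmin (Rmin d1 d2) (Rmin d3 d4)) (eps / (2 * (B * (N * N) + 1)))).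
    pose proof (Rmin_l (Rmin d1 d2) (Rmin d3 d4)).
    pose proof (Rmin_r (Rmin d1 d2) (Rmin d3 d4)).
    pose proof (Rmin_l d1 d2); pose proof (Rmin_r d1 d2).
    pose proof (Rmin_l d3 d4); pose proof (Rmin_r d3 d4); lra. }
  exists (mkposreal d Hd); simpl; intros y Hy Hyx.
  specialize (L1 y Hy ltac:(lra)); specialize (L2 y Hy ltac:(lra)).
  specialize (E1 y Hy ltac:(lra)); specialize (E2 y Hy ltac:(lra)).
  destruct (Hbd x Hx) as [Hfx Hgx]; destruct (Hbd y Hy) as [Hfy Hgy].
  destruct (mean_value_derive r (fun z => K z (g y)) (f x) (f y))
    as [z [Hz [Hz' Ez]]]; try assumption.
  { intros z Hz; exact (proj1 (HK z (g y) Hz Hgy)). }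
  destruct (mean_value_derive r (fun z => K (f x) z) (g x) (g y))
    as [w [Hw [Hw' Ew]]]; try assumption.
  { intros w Hw; exact (proj2 (HK (f x) w Hfx Hw)). }
  fold (K_u K z (g y)) in Ez; fold (K_v K (f x) w) in Ew.
  pose proof (Lu (f x) (g x) z (g y) Hfx Hgx Hz Hgy) as Du.
  pose proof (Lv (f x) (g x) (f x) w Hfx Hgx Hfx Hw) as Dv.
  fold ku in Du; fold kv in Dv.
  rewrite Rminus_diag, Rabs_R0, Rplus_0_l in Dv.
  set (h := Rabs (y - x)) in *.
  assert (Hh : 0 <= h) by apply Rabs_pos.
  set (p := Rabs (f y - f x)) in *; set (q := Rabs (g y - g x)) in *.
  assert (Hp : 0 <= p) by apply Rabs_pos.
  assert (Hq : 0 <= q) by apply Rabs_pos.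
  assert (Hpq : p + q <= N * h) by (unfold N; lra).
  replace (K (f y) (g y) - K (f x) (g x) - (y - x) * (ku * f' + kv * g'))
    with (((K_u K z (g y) - ku) * (f y - f x) + (K_v K (f x) w - kv) * (g y - g x))
      + (ku * (f y - f x - (y - x) * f') + kv * (g y - g x - (y - x) * g')))
    by lra.
  eapply Rle_trans; [apply Rabs_triang|].
  pose proof (Rabs_triang ((K_u K z (g y) - ku) * (f y - f x))
    ((K_v K (f x) w - kv) * (g y - g x))) as T1.
  pose proof (Rabs_triang (ku * (f y - f x - (y - x) * f'))
    (kv * (g y - g x - (y - x) * g'))) as T2.
  rewrite !Rabs_mult in T1, T2; fold p q in T1.
  assert (A1 : Rabs (K_u K z (g y) - ku) * p <= B * (N * h) * p).
  { apply Rmult_le_compat_r; [exact Hp|]; eapply Rle_trans; [exact Du|].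
    apply Rmult_le_compat_l; lra. }
  assert (A2 : Rabs (K_v K (f x) w - kv) * q <= B * (N * h) * q).
  { apply Rmult_le_compat_r; [exact Hq|]; eapply Rle_trans; [exact Dv|].
    apply Rmult_le_compat_l; lra. }
  assert (A3 : B * (N * h) * (p + q) <= B * (N * h) * (N * h)).
  { apply Rmult_le_compat_l; [repeat apply Rmult_le_pos; lra|exact Hpq]. }
  assert (A4 : B * (N * h) * (N * h) <= eps / 2 * h).
  { replace (B * (N * h) * (N * h)) with (B * (N * N) * h * h) by ring.
    apply Rmult_le_compat_r; [exact Hh|].
    apply Rle_trans with (B * (N * N) * (eps / (2 * (B * (N * N) + 1)))).
    - apply Rmult_le_compat_l; [repeat apply Rmult_le_pos; lra|lra].
    - assert (E : (B * (N * N) + 1) * (eps / (2 * (B * (N * N) + 1))) = eps / 2)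
        by (field; lra).
      lra. }
  assert (A5 : Rabs ku * Rabs (f y - f x - (y - x) * f')
    <= Rabs ku * (eps / (2 * P) * h))
    by (apply Rmult_le_compat_l; [apply Rabs_pos|exact E1]).
  assert (A6 : Rabs kv * Rabs (g y - g x - (y - x) * g')
    <= Rabs kv * (eps / (2 * P) * h))
    by (apply Rmult_le_compat_l; [apply Rabs_pos|exact E2]).
  assert (A7 : P * (eps / (2 * P) * h) = eps / 2 * h) by (field; lra).
  assert (A8 : 0 <= eps / (2 * P) * h) by (apply Rmult_le_pos; lra).
  unfold P in A7 at 1; lra.
Qed.

(** * Sup norms and differences of small solutions *)

Lemma real_lub_ge (E : R -> Prop) (M y : R) :
  (forall z, E z -> z <= M) -> E y -> y <= real (Lub_Rbar E).
Proof.
  intros HM Hy; destruct (Lub_Rbar_correct E) as [H1 H2].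
  assert (H3 : Rbar_le (Lub_Rbar E) M) by (apply H2; intros z Hz; exact (HM z Hz)).
  specialize (H1 y Hy); destruct (Lub_Rbar E) as [l| |]; simpl in *; tauto.
Qed.

Lemma real_lub_nonneg (E : R -> Prop) :
  (forall z, E z -> 0 <= z) -> 0 <= real (Lub_Rbar E).
Proof.
  intros H; destruct (Lub_Rbar_correct E) as [H1 H2].
  destruct (Lub_Rbar E) as [l| |] eqn:El; simpl; try lra.
  destruct (Rle_or_lt 0 l) as [|Hl]; [assumption|exfalso].
  destruct (classic (exists z, E z)) as [[z Hz]|Hn].
  - specialize (H1 z Hz); specialize (H z Hz); simpl in H1; lra.
  - apply (H2 m_infty); intros z Hz; exfalso; apply Hn; now exists z.
Qed.

Lemma sup_norm_nonneg (a b : R) (f : R -> R) : 0 <= sup_norm a b f.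
Proof. apply real_lub_nonneg; intros z [x [_ ->]]; apply Rabs_pos. Qed.

Lemma sup_norm_ge (a b M : R) (f : R -> R) (x : R) :
  (forall y, Icc a b y -> Rabs (f y) <= M) -> Icc a b x ->
  Rabs (f x) <= sup_norm a b f.
Proof.
  intros HM Hx; apply real_lub_ge with M; [intros z [y [Hy ->]]; auto|].
  now exists x.
Qed.

Lemma sup_norm_le (a b M : R) (f : R -> R) :
  a <= b -> (forall y, Icc a b y -> Rabs (f y) <= M) -> sup_norm a b f <= M.
Proof.
  intros Hab HM; unfold sup_norm.
  set (E := fun y => exists x, Icc a b x /\ y = Rabs (f x)).
  destruct (Lub_Rbar_correct E) as [H1 H2].
  assert (H3 : Rbar_le (Lub_Rbar E) M) by (apply H2; intros z [y [Hy ->]]; exact (HM y Hy)).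
  assert (Ha : Icc a b a) by (unfold Icc; lra).
  assert (HE : E (Rabs (f a))) by now exists a.
  specialize (H1 _ HE); destruct (Lub_Rbar E) as [l| |]; simpl in *; tauto.
Qed.

Lemma sup_norm_rect_ge (T L t x : R) (u : R -> R -> R) :
  cont_rect T L u -> rect T L (t, x) -> Rabs (u t x) <= sup_norm_rect T L u.
Proof.
  intros Hc Hp; destruct (cont_rect_bounded T L u Hc) as [M HM].
  apply real_lub_ge with M; [intros z [s [y [Hq ->]]]; auto|].
  now exists t, x.
Qed.

Definition jet_le (d : R) (J : jet) (t x : R) : Prop :=
  Rabs (val J t x) <= d /\ Rabs (d_t J t x) <= d /\ Rabs (d_x J t x) <= d /\
  Rabs (d_tt J t x) <= d /\ Rabs (d_tx J t x) <= d /\ Rabs (d_xx J t x) <= d.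

Definition gradient_le (A : R) (J : jet) (t x : R) : Prop :=
  Rabs (val J t x) <= A /\ Rabs (d_t J t x) <= A /\ Rabs (d_x J t x) <= A.

(** Time translations of solutions and the zero function satisfy this as well,
    which is why the initial and boundary conditions are left out. *)
Record jet_solution (K : R -> R -> R) (F : R -> R -> R -> R) (T L d : R)
    (J : jet) : Prop := {
  js_C2 : C2_jet T L J;
  js_le : forall t x, rect T L (t, x) -> jet_le d J t x;
  js_eq : forall t x, rect T L (t, x) ->
    d_tt J t x = K_u K (val J t x) (d_x J t x) * d_x J t x
      + K_v K (val J t x) (d_x J t x) * d_xx J t x
      + F (val J t x) (d_x J t x) (d_t J t x) }.

Lemma jet_solution_zero (K : R -> R -> R) (F : R -> R -> R -> R) (T L d : R) :
  0 <= d -> F 0 0 0 = 0 -> jet_solution K F T L d jet_zero.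
Proof.
  intros Hd HF; split.
  - apply C2_jet_zero.
  - intros t x _; unfold jet_le; simpl; rewrite Rabs_R0; tauto.
  - intros t x _; simpl; rewrite HF; ring.
Qed.

Lemma jet_solution_shift (K : R -> R -> R) (F : R -> R -> R -> R)
    (T T' L d s : R) (J : jet) :
  0 <= s -> T' + s <= T -> jet_solution K F T L d J ->
  jet_solution K F T' L d (jet_shift s J).
Proof.
  intros Hs HT [H1 H2 H3].
  assert (Hr : forall t x, rect T' L (t, x) -> rect T L (t + s, x)).
  { unfold rect, Icc; simpl; intros; lra. }
  split.
  - now apply C2_jet_shift with T.
  - intros t x Hp; exact (H2 _ _ (Hr t x Hp)).
  - intros t x Hp; exact (H3 _ _ (Hr t x Hp)).
Qed.

Lemma small_solution_jet (K : R -> R -> R) (F : R -> R -> R -> R)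
    (r B c1 c2 T L d : R) (phi psi h hbar : R -> R) (u : R -> R -> R) :
  tame K F r B c1 c2 -> 0 < T -> 0 < L -> d < r ->
  small_solution K F T L d phi psi h hbar u ->
  jet_solution K F T L d (jet_of T L u).
Proof.
  intros HK HT HL Hd [[HC2 [Heq _]] Hn].
  pose proof (C2_rect_jet T L u HT HL HC2) as HJ.
  pose proof HJ as [[H0 [C0 [Ct Cx]]] [[_ [_ [Ctt Ctx]]] [Hx [_ [_ Cxx]]]]].
  simpl in *.
  assert (Hle : forall t x, rect T L (t, x) -> jet_le d (jet_of T L u) t x).
  { intros t x Hp.
    pose proof (sup_norm_rect_ge T L t x _ C0 Hp).
    pose proof (sup_norm_rect_ge T L t x _ Ct Hp).
    pose proof (sup_norm_rect_ge T L t x _ Cx Hp).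
    pose proof (sup_norm_rect_ge T L t x _ Ctt Hp).
    pose proof (sup_norm_rect_ge T L t x _ Ctx Hp).
    pose proof (sup_norm_rect_ge T L t x _ Cxx Hp).
    pose proof (Rabs_pos (u t x)).
    pose proof (Rabs_pos (D_t T u t x)).
    pose proof (Rabs_pos (Defs.D_x L u t x)).
    pose proof (Rabs_pos (D_t T (D_t T u) t x)).
    pose proof (Rabs_pos (Defs.D_x L (D_t T u) t x)).
    pose proof (Rabs_pos (Defs.D_x L (Defs.D_x L u) t x)).
    unfold C2_norm_rect in Hn; unfold jet_le; simpl; lra. }
  split; [exact HJ|exact Hle|].
  intros t x Hp; simpl.
  rewrite <- (Heq t x Hp).
  assert (E : Defs.D_x L (fun s y => K (u s y) (Defs.D_x L u s y)) t x =
    K_u K (u t x) (Defs.D_x L u t x) * Defs.D_x L u t x +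
    K_v K (u t x) (Defs.D_x L u t x) * Defs.D_x L (Defs.D_x L u) t x).
  { apply is_derive_on_unique; [exact HL|exact (proj2 Hp)|].
    destruct HK as [_ HB _ Hdiff HKu HKv _ _ _].
    apply (chain_rule_on 0 L r B K (fun y => u t y) (fun y => Defs.D_x L u t y));
      try assumption.
    - exact (proj2 Hp).
    - intros y Hy; destruct (Hle t y (conj (proj1 Hp) Hy)) as [L1 [_ [L2 _]]].
      simpl in *; lra.
    - exact (proj2 (H0 t x Hp)).
    - exact (proj2 (Hx t x Hp)). }
  lra.
Qed.

Lemma sqrt_lipschitz (c a b : R) :
  0 < c -> c * c <= a -> c * c <= b -> Rabs (sqrt a - sqrt b) <= Rabs (a - b) / c.
Proof.
  intros Hc Ha Hb.
  assert (H : forall z, c * c <= z -> c <= sqrt z /\ sqrt z * sqrt z = z).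
  { intros z Hz; split; [|apply sqrt_sqrt; nra].
    rewrite <- (sqrt_square c) by lra; now apply sqrt_le_1_alt. }
  destruct (H a Ha) as [H1 H2]; destruct (H b Hb) as [H3 H4].
  apply Rmult_le_reg_r with c; [exact Hc|].
  replace (Rabs (a - b) / c * c) with (Rabs (a - b)) by (field; lra).
  replace (a - b) with ((sqrt a - sqrt b) * (sqrt a + sqrt b)) by lra.
  rewrite Rabs_mult, (Rabs_pos_eq (sqrt a + sqrt b)) by lra.
  apply Rmult_le_compat_l; [apply Rabs_pos|lra].
Qed.

Definition speed (K : R -> R -> R) (J : jet) (t x : R) : R :=
  sqrt (K_v K (val J t x) (d_x J t x)).

Lemma speed_lip (K : R -> R -> R) (F : R -> R -> R -> R)
    (r B c1 c2 T L d : R) (J : jet) :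
  tame K F r B c1 c2 -> 0 <= d < r -> jet_solution K F T L d J ->
  lip_rect T L (2 * B * r / c1) (speed K J).
Proof.
  intros HK Hd [[HJ0 [_ HJx]] Hle _] t x s y Hp Hq.
  destruct HK as [_ HB Hc _ _ HKv _ HKvb _].
  destruct (Hle t x Hp) as [P1 [_ [P2 _]]]; destruct (Hle s y Hq) as [Q1 [_ [Q2 _]]].
  eapply Rle_trans; [apply (sqrt_lipschitz c1); [lra| |]; apply HKvb; lra|].
  assert (L0 : lip_rect T L r (val J)).
  { apply C1_jet_lip with (d_t J) (d_x J); [exact HJ0|].
    intros t' x' Hp'; destruct (Hle t' x' Hp') as [_ [? [? _]]]; lra. }
  assert (L1 : lip_rect T L r (d_x J)).
  { apply C1_jet_lip with (d_tx J) (d_xx J); [exact HJx|].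
    intros t' x' Hp'; destruct (Hle t' x' Hp') as [_ [_ [_ [_ [? ?]]]]]; lra. }
  specialize (L0 t x s y Hp Hq); specialize (L1 t x s y Hp Hq).
  set (D := Rabs (s - t) + Rabs (y - x)) in *.
  assert (H : Rabs (K_v K (val J s y) (d_x J s y) - K_v K (val J t x) (d_x J t x))
    <= B * (r * D + r * D)).
  { eapply Rle_trans; [apply HKv; lra|]; apply Rmult_le_compat_l; lra. }
  replace (2 * B * r / c1 * D) with (B * (r * D + r * D) / c1) by (field; lra).
  apply Rmult_le_compat_r; [left; apply Rinv_0_lt_compat; lra|exact H].
Qed.

Lemma speed_bounds (K : R -> R -> R) (F : R -> R -> R -> R)
    (r B c1 c2 T L d : R) (J : jet) (t x : R) :
  tame K F r B c1 c2 -> 0 <= d < r -> jet_solution K F T L d J ->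
  rect T L (t, x) ->
  c1 <= speed K J t x <= c2 /\
  speed K J t x * speed K J t x = K_v K (val J t x) (d_x J t x).
Proof.
  intros [_ _ Hc _ _ _ _ HKvb _] Hd [_ Hle _] Hp.
  destruct (Hle t x Hp) as [P1 [_ [P2 _]]].
  destruct (HKvb (val J t x) (d_x J t x) ltac:(lra) ltac:(lra)) as [H1 H2].
  unfold speed; split; [|apply sqrt_sqrt; nra].
  rewrite <- (sqrt_square c1), <- (sqrt_square c2) by lra.
  split; now apply sqrt_le_1_alt.
Qed.

(** The principal part is taken at the first solution; the second derivatives
    of the second one then appear multiplied by differences of coefficients,
    and they are bounded. *)
Lemma difference_wave_ineq (K : R -> R -> R) (F : R -> R -> R -> R)
    (r B c1 c2 T L d : R) (J1 J2 : jet) :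
  tame K F r B c1 c2 -> 0 <= d < r -> jet_solution K F T L d J1 ->
  jet_solution K F T L d J2 ->
  wave_ineq T L (2 * B * (1 + r)) (speed K J1) (jet_sub J1 J2).
Proof.
  intros HK Hd S1 S2 t x Hp.
  destruct (speed_bounds K F r B c1 c2 T L d J1 t x HK Hd S1 Hp) as [_ Hsp].
  rewrite Hsp; simpl.
  destruct HK as [Hr HB Hc _ HKu HKv HKub HKvb HF].
  destruct S1 as [_ Hle1 Heq1], S2 as [_ Hle2 Heq2].
  rewrite (Heq1 t x Hp), (Heq2 t x Hp).
  destruct (Hle1 t x Hp) as [P0 [Pt [Px [_ [_ Pxx]]]]].
  destruct (Hle2 t x Hp) as [Q0 [Qt [Qx [_ [_ Qxx]]]]].
  set (u1 := val J1 t x) in *; set (v1 := d_x J1 t x) in *;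
    set (w1 := d_t J1 t x) in *; set (z1 := d_xx J1 t x) in *.
  set (u2 := val J2 t x) in *; set (v2 := d_x J2 t x) in *;
    set (w2 := d_t J2 t x) in *; set (z2 := d_xx J2 t x) in *.
  replace (K_u K u1 v1 * v1 + K_v K u1 v1 * z1 + F u1 v1 w1 -
    (K_u K u2 v2 * v2 + K_v K u2 v2 * z2 + F u2 v2 w2) -
    K_v K u1 v1 * (z1 - z2))
    with ((K_u K u1 v1 * (v1 - v2) + (K_u K u1 v1 - K_u K u2 v2) * v2) +
      ((K_v K u1 v1 - K_v K u2 v2) * z2 + (F u1 v1 w1 - F u2 v2 w2))) by ring.
  eapply Rle_trans; [apply Rabs_triang|].
  pose proof (Rabs_triang (K_u K u1 v1 * (v1 - v2))
    ((K_u K u1 v1 - K_u K u2 v2) * v2)) as T1.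
  pose proof (Rabs_triang ((K_v K u1 v1 - K_v K u2 v2) * z2)
    (F u1 v1 w1 - F u2 v2 w2)) as T2.
  rewrite !Rabs_mult in T1; rewrite Rabs_mult in T2.
  pose proof (HKu u2 v2 u1 v1 ltac:(lra) ltac:(lra) ltac:(lra) ltac:(lra)) as D1.
  pose proof (HKv u2 v2 u1 v1 ltac:(lra) ltac:(lra) ltac:(lra) ltac:(lra)) as D2.
  pose proof (HF u2 v2 w2 u1 v1 w1 ltac:(lra) ltac:(lra) ltac:(lra) ltac:(lra)
    ltac:(lra) ltac:(lra)) as D3.
  pose proof (HKub u1 v1 ltac:(lra) ltac:(lra)) as D4.
  set (a := Rabs (u1 - u2)) in *; set (b := Rabs (v1 - v2)) in *;
    set (c := Rabs (w1 - w2)) in *.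
  assert (Ha : 0 <= a) by apply Rabs_pos.
  assert (Hb : 0 <= b) by apply Rabs_pos.
  assert (Hcc : 0 <= c) by apply Rabs_pos.
  assert (HBa : 0 <= B * a) by now apply Rmult_le_pos.
  assert (HBb : 0 <= B * b) by now apply Rmult_le_pos.
  assert (HBc : 0 <= B * c) by now apply Rmult_le_pos.
  assert (HBrc : 0 <= B * c * r) by (apply Rmult_le_pos; lra).
  assert (A1 : Rabs (K_u K u1 v1) * b <= B * b) by now apply Rmult_le_compat_r.
  assert (A2 : Rabs (K_u K u1 v1 - K_u K u2 v2) * Rabs v2 <= B * (a + b) * r)
    by (apply Rmult_le_compat; try apply Rabs_pos; lra).
  assert (A3 : Rabs (K_v K u1 v1 - K_v K u2 v2) * Rabs z2 <= B * (a + b) * r)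
    by (apply Rmult_le_compat; try apply Rabs_pos; lra).
  lra.
Qed.

(** The constant is uniform in [T <= T0]: translates of a solution are compared
    on slightly shorter time intervals. *)
Lemma difference_estimate (K : R -> R -> R) (F : R -> R -> R -> R)
    (r B c1 c2 L T0 d : R) :
  tame K F r B c1 c2 -> 0 < L -> 0 < T0 -> 0 <= d < r ->
  exists C, 0 < C /\ forall T J1 J2 A, L <= c1 * T -> T <= T0 -> 0 <= A ->
    jet_solution K F T L d J1 -> jet_solution K F T L d J2 ->
    (forall t x, Icc 0 T t -> x = 0 \/ x = L ->
       gradient_le A (jet_sub J1 J2) t x) ->
    forall x, Icc 0 L x -> gradient_le (C * A) (jet_sub J1 J2) 0 x.
Proof.
  intros HK HL HT0 Hd.
  pose proof HK as [Hr HB Hc _ _ _ _ _ _].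
  assert (Hic : 0 < / c1) by (apply Rinv_0_lt_compat; lra).
  assert (HLam : 0 <= 2 * B * r / c1)
    by (unfold Rdiv; repeat apply Rmult_le_pos; lra).
  destruct (lateral_to_initial L T0 c1 c2 (2 * B * r / c1) (2 * B * (1 + r)))
    as [C [HC H]]; try assumption.
  { repeat apply Rmult_le_pos; lra. }
  exists (C * (1 + / c1)); split; [apply Rmult_lt_0_compat; lra|].
  intros T J1 J2 A HLT HT HA S1 S2 Hlat x Hx.
  assert (H0T : 0 < T) by (apply Rmult_lt_reg_l with c1; lra).
  assert (Hamp : amp (speed K J1) (jet_sub J1 J2) 0 x <= C * A).
  { apply (H T); try assumption.
    - apply C2_jet_sub; [exact (js_C2 _ _ _ _ _ _ S1)|exact (js_C2 _ _ _ _ _ _ S2)].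
    - now apply (speed_lip K F r B c1 c2 T L d).
    - intros t y Hp; now apply (speed_bounds K F r B c1 c2 T L d).
    - now apply (difference_wave_ineq K F r B c1 c2 T L d). }
  assert (Hp : rect T L (0, x)) by (split; [unfold Icc; simpl; lra|exact Hx]).
  destruct (speed_bounds K F r B c1 c2 T L d J1 0 x HK Hd S1 Hp) as [Hs _].
  destruct (amp_bounds (speed K J1) (jet_sub J1 J2) c1 0 x ltac:(lra))
    as [B1 [B2 B3]].
  assert (HCA : 0 <= C * A * / c1) by (repeat apply Rmult_le_pos; lra).
  assert (HCA' : 0 <= C * A) by (apply Rmult_le_pos; lra).
  assert (B4 : amp (speed K J1) (jet_sub J1 J2) 0 x / c1 <= C * A * / c1)
    by (apply Rmult_le_compat_r; lra).
  unfold gradient_le; lra.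
Qed.

Lemma Derive_on_eq (a b : R) (f g : R -> R) (x l : R) :
  a < b -> Icc a b x -> (forall y, Icc a b y -> f y = g y) ->
  is_derive_on a b g x l -> Derive_on a b f x = l.
Proof.
  intros Hab Hx E H; apply is_derive_on_unique; try assumption.
  apply is_derive_on_ext with g; [exact Hx|intros y Hy; symmetry; auto|exact H].
Qed.

(** * Observability *)

Definition lateral_le (A : R) (J : jet) (t x : R) : Prop :=
  gradient_le A J t x /\ Rabs (d_tt J t x) <= A /\ Rabs (d_tx J t x) <= A.

(** Comparison with the zero solution bounds the function and its gradient.
    Comparison with the translate by [s], whose lateral differences are at most
    [A * s], bounds the time increments of the gradient, hence [d_tt] and
    [d_tx]; the equation, solved for [d_xx], gives the remaining derivative. *)
Lemma initial_jet_estimate (K : R -> R -> R) (F : R -> R -> R -> R)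
    (r B c1 c2 T L d : R) :
  tame K F r B c1 c2 -> F 0 0 0 = 0 -> 0 < L -> L < c1 * T -> 0 <= d < r ->
  exists C, 0 < C /\ forall J A, 0 <= A -> jet_solution K F T L d J ->
    (forall t x, Icc 0 T t -> x = 0 \/ x = L -> lateral_le A J t x) ->
    forall x, Icc 0 L x -> jet_le (C * A) J 0 x.
Proof.
  intros HK HF0 HL HLT Hd.
  pose proof HK as [Hr HB Hc _ _ _ HKub HKvb HF].
  assert (HT : 0 < T) by (apply Rmult_lt_reg_l with c1; lra).
  destruct (difference_estimate K F r B c1 c2 L T d HK HL HT Hd) as [C [HC H]].
  assert (Hc1 : 0 < c1 * c1) by (apply Rmult_lt_0_compat; lra).
  set (C' := C * (1 + 4 * B) / (c1 * c1)).
  assert (HC' : 0 < C').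
  { apply Rdiv_lt_0_compat; [apply Rmult_lt_0_compat; lra|exact Hc1]. }
  exists (C + C'); split; [lra|].
  intros J A HA HJ Hlat x Hx.
  pose proof HJ as [[HJ0 [HJt HJx]] Hle Heq].
  assert (HCA : 0 <= C * A) by (apply Rmult_le_pos; lra).
  assert (HCA' : 0 <= C' * A) by (apply Rmult_le_pos; lra).
  assert (Hp : rect T L (0, x)) by (split; [unfold Icc; simpl; lra|exact Hx]).
  assert (G : gradient_le (C * A) J 0 x).
  { destruct (H T J jet_zero A ltac:(lra) ltac:(lra) HA HJ
      (jet_solution_zero K F T L d ltac:(lra) HF0)) with (x := x) as [G1 [G2 G3]].
    - intros t y Ht Hy; destruct (Hlat t y Ht Hy) as [G _].
      unfold gradient_le in *; simpl; now rewrite !Rminus_0_r.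
    - exact Hx.
    - simpl in *; rewrite !Rminus_0_r in *; split; [|split]; assumption. }
  set (s0 := T - L / c1).
  assert (Hs0 : 0 < s0).
  { unfold s0; assert (L / c1 < T); [|lra].
    apply Rmult_lt_reg_l with c1; [lra|].
    replace (c1 * (L / c1)) with L by (field; lra); exact HLT. }
  assert (Hinc : forall s, 0 < s < s0 ->
    Rabs (d_t J s x - d_t J 0 x) <= C * A * s /\
    Rabs (d_x J s x - d_x J 0 x) <= C * A * s).
  { intros s Hs.
    assert (HLs : L <= c1 * (T - s)).
    { replace L with (c1 * (L / c1)) by (field; lra).
      apply Rmult_le_compat_l; unfold s0 in Hs; lra. }
    assert (HAs : 0 <= A * s) by (apply Rmult_le_pos; lra).
    destruct (H (T - s) (jet_shift s J) (jet_shift 0 J) (A * s) HLs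
      ltac:(lra) HAs (jet_solution_shift K F T (T - s) L d s J ltac:(lra)
        ltac:(lra) HJ) (jet_solution_shift K F T (T - s) L d 0 J ltac:(lra)
        ltac:(lra) HJ)) with (x := x) as [_ [G2 G3]].
    - intros t y Ht Hy.
      assert (Hy' : Icc 0 L y) by (unfold Icc; destruct Hy; lra).
      assert (Hlip : forall f ft fy, C1_jet T L f ft fy ->
        (forall z, Icc 0 T z -> Rabs (ft z y) <= A) ->
        Rabs (f (t + s) y - f (t + 0) y) <= A * s).
      { intros f ft fy [Hf _] Hb.
        eapply Rle_trans.
        - apply (lipschitz_on 0 T A (fun z => f z y) (fun z => ft z y)).
          + intros z Hz; exact (proj1 (Hf z y (conj Hz Hy'))).
          + exact Hb.
          + unfold Icc in *; lra.
          + unfold Icc in *; lra.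
        - replace (t + s - (t + 0)) with s by ring; rewrite Rabs_pos_eq; lra. }
      split; [|split].
      + apply (Hlip _ _ _ HJ0); intros z Hz; apply (Hlat z y Hz Hy).
      + apply (Hlip _ _ _ HJt); intros z Hz; apply (Hlat z y Hz Hy).
      + apply (Hlip _ _ _ HJx); intros z Hz; apply (Hlat z y Hz Hy).
    - exact Hx.
    - simpl in G2, G3; rewrite !Rplus_0_l in G2, G3.
      rewrite Rmult_assoc; split; assumption. }
  assert (Gtt : Rabs (d_tt J 0 x) <= C * A).
  { apply (derivative_bound T (fun z => d_t J z x) _ _ s0 HT Hs0).
    - exact (proj1 (proj1 HJt 0 x Hp)).
    - intros s Hs; now apply Hinc. }
  assert (Gtx : Rabs (d_tx J 0 x) <= C * A).
  { apply (derivative_bound T (fun z => d_x J z x) _ _ s0 HT Hs0).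
    - exact (proj1 (proj1 HJx 0 x Hp)).
    - intros s Hs; now apply Hinc. }
  destruct G as [G0 [Gt Gx]].
  assert (Gxx : Rabs (d_xx J 0 x) <= C' * A).
  { destruct (Hle 0 x Hp) as [P0 [Pt [Px _]]].
    pose proof (Heq 0 x Hp) as E.
    pose proof (HKub (val J 0 x) (d_x J 0 x) ltac:(lra) ltac:(lra)) as Bu.
    pose proof (HKvb (val J 0 x) (d_x J 0 x) ltac:(lra) ltac:(lra)) as Bv.
    assert (R0 : Rabs 0 < r) by (rewrite Rabs_R0; lra).
    pose proof (HF 0 0 0 (val J 0 x) (d_x J 0 x) (d_t J 0 x) R0 R0 R0
      ltac:(lra) ltac:(lra) ltac:(lra)) as BF.
    rewrite HF0, !Rminus_0_r in BF.
    set (ku := K_u K (val J 0 x) (d_x J 0 x)) in *.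
    set (kv := K_v K (val J 0 x) (d_x J 0 x)) in *.
    set (f := F (val J 0 x) (d_x J 0 x) (d_t J 0 x)) in *.
    assert (E' : kv * d_xx J 0 x = d_tt J 0 x + - (ku * d_x J 0 x + f)) by lra.
    apply (f_equal Rabs) in E'.
    rewrite Rabs_mult, (Rabs_pos_eq kv) in E' by lra.
    pose proof (Rabs_triang (d_tt J 0 x) (- (ku * d_x J 0 x + f))) as T1.
    pose proof (Rabs_triang (ku * d_x J 0 x) f) as T2.
    rewrite Rabs_Ropp in T1; rewrite Rabs_mult in T2.
    assert (A1 : Rabs ku * Rabs (d_x J 0 x) <= B * (C * A))
      by (apply Rmult_le_compat; try apply Rabs_pos; assumption).
    assert (A2 : B * (Rabs (val J 0 x) + Rabs (d_x J 0 x) + Rabs (d_t J 0 x))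
      <= B * (3 * (C * A))) by (apply Rmult_le_compat_l; lra).
    assert (A3 : c1 * c1 * Rabs (d_xx J 0 x) <= kv * Rabs (d_xx J 0 x))
      by (apply Rmult_le_compat_r; [apply Rabs_pos|lra]).
    apply Rmult_le_reg_l with (c1 * c1); [exact Hc1|].
    replace (c1 * c1 * (C' * A)) with (C * (1 + 4 * B) * A)
      by (unfold C'; field; lra).
    lra. }
  unfold jet_le; lra.
Qed.

Lemma boundary_condition_jet (K : R -> R -> R) (F : R -> R -> R -> R)
    (T L : R) (phi psi h hbar : R -> R) (u : R -> R -> R) (t : R) :
  0 < T -> 0 < L -> solves K F T L phi psi h hbar u -> Icc 0 T t ->
  Derive_on 0 T h t = D_t T u t 0 - D_t T u t L /\
  Derive_on 0 T (Derive_on 0 T h) t =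
    D_t T (D_t T u) t 0 - D_t T (D_t T u) t L /\
  Derive_on 0 T hbar t =
    Defs.D_x L (D_t T u) t 0 - Defs.D_x L (D_t T u) t L.
Proof.
  intros HT HL [HC2 [_ [_ Hbc]]] Ht.
  destruct (C2_rect_jet T L u HT HL HC2) as [[H0 _] [[H1 _] [H2 _]]]; simpl in *.
  assert (Hr : forall s, Icc 0 T s -> rect T L (s, 0) /\ rect T L (s, L)).
  { intros s Hs; unfold rect, Icc in *; simpl; lra. }
  assert (D1 : forall s, Icc 0 T s ->
    Derive_on 0 T h s = D_t T u s 0 - D_t T u s L).
  { intros s Hs.
    apply Derive_on_eq with (fun z => u z 0 - u z L); try assumption.
    - intros z Hz; symmetry; exact (proj1 (Hbc z Hz)).
    - apply is_derive_on_minus; [exact (proj1 (H0 _ _ (proj1 (Hr s Hs))))|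
      exact (proj1 (H0 _ _ (proj2 (Hr s Hs))))]. }
  split; [now apply D1|split].
  - apply Derive_on_eq with (fun z => D_t T u z 0 - D_t T u z L); try assumption.
    apply is_derive_on_minus; [exact (proj1 (H1 _ _ (proj1 (Hr t Ht))))|
      exact (proj1 (H1 _ _ (proj2 (Hr t Ht))))].
  - apply Derive_on_eq with (fun z => Defs.D_x L u z 0 - Defs.D_x L u z L);
      try assumption.
    + intros z Hz; symmetry; exact (proj2 (Hbc z Hz)).
    + apply is_derive_on_minus; [exact (proj1 (H2 _ _ (proj1 (Hr t Ht))))|
      exact (proj1 (H2 _ _ (proj2 (Hr t Ht))))].
Qed.

Lemma initial_condition_jet (K : R -> R -> R) (F : R -> R -> R -> R)
    (T L : R) (phi psi h hbar : R -> R) (u : R -> R -> R) (x : R) :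
  0 < T -> 0 < L -> solves K F T L phi psi h hbar u -> Icc 0 L x ->
  Derive_on 0 L phi x = Defs.D_x L u 0 x /\
  Derive_on 0 L (Derive_on 0 L phi) x = Defs.D_x L (Defs.D_x L u) 0 x /\
  Derive_on 0 L psi x = Defs.D_x L (D_t T u) 0 x.
Proof.
  intros HT HL [HC2 [_ [Hic _]]] Hx.
  destruct (C2_rect_jet T L u HT HL HC2) as [[H0 _] [[H1 _] [H2 _]]]; simpl in *.
  assert (Hr : forall y, Icc 0 L y -> rect T L (0, y)).
  { intros y Hy; split; [unfold Icc; simpl; lra|exact Hy]. }
  assert (D1 : forall y, Icc 0 L y -> Derive_on 0 L phi y = Defs.D_x L u 0 y).
  { intros y Hy; apply Derive_on_eq with (u 0); try assumption.
    - intros z Hz; symmetry; exact (proj1 (Hic z Hz)).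
    - exact (proj2 (H0 _ _ (Hr y Hy))). }
  split; [now apply D1|split].
  - apply Derive_on_eq with (Defs.D_x L u 0); try assumption.
    exact (proj2 (H2 _ _ (Hr x Hx))).
  - apply Derive_on_eq with (D_t T u 0); try assumption.
    + intros z Hz; symmetry; exact (proj2 (Hic z Hz)).
    + exact (proj2 (H1 _ _ (Hr x Hx))).
Qed.

(** At [x = L] the traces are those at [x = 0] minus the boundary functions. *)
Lemma lateral_bound (K : R -> R -> R) (F : R -> R -> R -> R)
    (T L d : R) (phi psi h hbar : R -> R) (u : R -> R -> R) (t x : R) :
  0 < T -> 0 < L -> solves K F T L phi psi h hbar u ->
  jet_solution K F T L d (jet_of T L u) -> Icc 0 T t -> x = 0 \/ x = L ->
  lateral_le (C2C1_norm 0 T (obs_u u) (obs_v L u) + C2C1_norm 0 T h hbar)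
    (jet_of T L u) t x.
Proof.
  intros HT HL Hsol HJ Ht Hx.
  pose proof (C2_rect_jet T L u HT HL (proj1 Hsol)) as [_ [_ [H2 _]]]; simpl in H2.
  pose proof (fun s => boundary_condition_jet K F T L phi psi h hbar u s
    HT HL Hsol) as Hbd.
  destruct Hsol as [_ [_ [_ Hbc]]].
  assert (Hle0 : forall s, Icc 0 T s -> jet_le d (jet_of T L u) s 0).
  { intros s Hs; apply HJ; unfold rect, Icc in *; simpl; lra. }
  assert (HleL : forall s, Icc 0 T s -> jet_le d (jet_of T L u) s L).
  { intros s Hs; apply HJ; unfold rect, Icc in *; simpl; lra. }
  unfold jet_le in Hle0, HleL; simpl in Hle0, HleL.
  assert (Etx : forall s, Icc 0 T s ->
    Derive_on 0 T (obs_v L u) s = Defs.D_x L (D_t T u) s 0).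
  { intros s Hs; apply is_derive_on_unique; [exact HT|exact Hs|].
    apply (H2 s 0); unfold rect, Icc in *; simpl; lra. }
  assert (Hdiff : forall a b, Rabs a <= d -> Rabs b <= d ->
    Rabs (a - b) <= d + d).
  { intros a b Ha Hb; unfold Rminus; eapply Rle_trans; [apply Rabs_triang|].
    rewrite Rabs_Ropp; lra. }
  (* The boundary functions are differences of traces of [u], hence bounded. *)
  assert (N1 : Rabs (u t 0) <= sup_norm 0 T (obs_u u)).
  { apply (sup_norm_ge 0 T d (obs_u u)); [|exact Ht].
    intros s Hs; exact (proj1 (Hle0 s Hs)). }
  assert (N2 : Rabs (D_t T u t 0) <= sup_norm 0 T (Derive_on 0 T (obs_u u))).
  { apply (sup_norm_ge 0 T d (Derive_on 0 T (obs_u u))); [|exact Ht].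
    intros s Hs; exact (proj1 (proj2 (Hle0 s Hs))). }
  assert (N3 : Rabs (D_t T (D_t T u) t 0) <=
    sup_norm 0 T (Derive_on 0 T (Derive_on 0 T (obs_u u)))).
  { apply (sup_norm_ge 0 T d (Derive_on 0 T (Derive_on 0 T (obs_u u))));
      [|exact Ht].
    intros s Hs; exact (proj1 (proj2 (proj2 (proj2 (Hle0 s Hs))))). }
  assert (N4 : Rabs (Defs.D_x L u t 0) <= sup_norm 0 T (obs_v L u)).
  { apply (sup_norm_ge 0 T d (obs_v L u)); [|exact Ht].
    intros s Hs; exact (proj1 (proj2 (proj2 (Hle0 s Hs)))). }
  assert (N5 : Rabs (Defs.D_x L (D_t T u) t 0) <=
    sup_norm 0 T (Derive_on 0 T (obs_v L u))).
  { rewrite <- Etx by exact Ht.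
    apply (sup_norm_ge 0 T d (Derive_on 0 T (obs_v L u))); [|exact Ht].
    intros s Hs; rewrite Etx by exact Hs;
      exact (proj1 (proj2 (proj2 (proj2 (proj2 (Hle0 s Hs)))))). }
  assert (M1 : Rabs (h t) <= sup_norm 0 T h).
  { apply sup_norm_ge with (d + d); [|exact Ht]; intros s Hs.
    rewrite <- (proj1 (Hbc s Hs)); apply Hdiff;
      [exact (proj1 (Hle0 s Hs))|exact (proj1 (HleL s Hs))]. }
  assert (M2 : Rabs (Derive_on 0 T h t) <= sup_norm 0 T (Derive_on 0 T h)).
  { apply sup_norm_ge with (d + d); [|exact Ht]; intros s Hs.
    rewrite (proj1 (Hbd s Hs)); apply Hdiff;
      [exact (proj1 (proj2 (Hle0 s Hs)))|exact (proj1 (proj2 (HleL s Hs)))]. }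
  assert (M3 : Rabs (Derive_on 0 T (Derive_on 0 T h) t) <=
    sup_norm 0 T (Derive_on 0 T (Derive_on 0 T h))).
  { apply sup_norm_ge with (d + d); [|exact Ht]; intros s Hs.
    rewrite (proj1 (proj2 (Hbd s Hs))); apply Hdiff;
      [exact (proj1 (proj2 (proj2 (proj2 (Hle0 s Hs)))))|
       exact (proj1 (proj2 (proj2 (proj2 (HleL s Hs)))))]. }
  assert (M4 : Rabs (hbar t) <= sup_norm 0 T hbar).
  { apply sup_norm_ge with (d + d); [|exact Ht]; intros s Hs.
    rewrite <- (proj2 (Hbc s Hs)); apply Hdiff;
      [exact (proj1 (proj2 (proj2 (Hle0 s Hs))))|exact (proj1 (proj2 (proj2 (HleL s Hs))))]. }
  assert (M5 : Rabs (Derive_on 0 T hbar t) <= sup_norm 0 T (Derive_on 0 T hbar)).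
  { apply sup_norm_ge with (d + d); [|exact Ht]; intros s Hs.
    rewrite (proj2 (proj2 (Hbd s Hs))); apply Hdiff;
      [exact (proj1 (proj2 (proj2 (proj2 (proj2 (Hle0 s Hs))))))|
       exact (proj1 (proj2 (proj2 (proj2 (proj2 (HleL s Hs))))))]. }
  destruct (Hbc t Ht) as [E1 E4]; destruct (Hbd t Ht) as [E2 [E3 E5]].
  rewrite <- E1 in M1; rewrite E2 in M2; rewrite E3 in M3;
    rewrite <- E4 in M4; rewrite E5 in M5.
  assert (Hsub : forall a b p q, Rabs a <= p -> Rabs (a - b) <= q ->
    Rabs b <= p + q).
  { intros a b p q Ha Hb; replace b with (a + - (a - b)) by ring.
    eapply Rle_trans; [apply Rabs_triang|]; rewrite Rabs_Ropp; lra. }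
  pose proof (Hsub _ _ _ _ N1 M1); pose proof (Hsub _ _ _ _ N2 M2).
  pose proof (Hsub _ _ _ _ N3 M3); pose proof (Hsub _ _ _ _ N4 M4).
  pose proof (Hsub _ _ _ _ N5 M5).
  pose proof (sup_norm_nonneg 0 T (obs_u u)).
  pose proof (sup_norm_nonneg 0 T (Derive_on 0 T (obs_u u))).
  pose proof (sup_norm_nonneg 0 T (Derive_on 0 T (Derive_on 0 T (obs_u u)))).
  pose proof (sup_norm_nonneg 0 T (obs_v L u)).
  pose proof (sup_norm_nonneg 0 T (Derive_on 0 T (obs_v L u))).
  pose proof (sup_norm_nonneg 0 T h).
  pose proof (sup_norm_nonneg 0 T (Derive_on 0 T h)).
  pose proof (sup_norm_nonneg 0 T (Derive_on 0 T (Derive_on 0 T h))).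
  pose proof (sup_norm_nonneg 0 T hbar).
  pose proof (sup_norm_nonneg 0 T (Derive_on 0 T hbar)).
  unfold C2C1_norm, C2_norm, C1_norm, lateral_le, gradient_le; simpl.
  destruct Hx as [-> | ->]; lra.
Qed.

Lemma initial_data_unique (K : R -> R -> R) (F : R -> R -> R -> R)
    (r B c1 c2 T L d : R) (phi1 psi1 phi2 psi2 h hbar : R -> R)
    (u1 u2 : R -> R -> R) :
  tame K F r B c1 c2 -> 0 < L -> L < c1 * T -> 0 <= d < r ->
  small_solution K F T L d phi1 psi1 h hbar u1 ->
  small_solution K F T L d phi2 psi2 h hbar u2 ->
  (forall t, Icc 0 T t ->
     obs_u u1 t = obs_u u2 t /\ obs_v L u1 t = obs_v L u2 t) ->
  forall x, Icc 0 L x -> phi1 x = phi2 x /\ psi1 x = psi2 x.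
Proof.
  intros HK HL HLT Hd S1 S2 Hobs x Hx.
  assert (HT : 0 < T).
  { apply Rmult_lt_reg_l with c1; [apply (tame_c _ _ _ _ _ _ HK)|lra]. }
  pose proof (small_solution_jet K F r B c1 c2 T L d _ _ _ _ u1 HK HT HL
    ltac:(lra) S1) as J1.
  pose proof (small_solution_jet K F r B c1 c2 T L d _ _ _ _ u2 HK HT HL
    ltac:(lra) S2) as J2.
  destruct (difference_estimate K F r B c1 c2 L T d HK HL HT Hd) as [C [_ H]].
  destruct S1 as [[_ [_ [I1 B1]]] _], S2 as [[_ [_ [I2 B2]]] _].
  destruct (H T (jet_of T L u1) (jet_of T L u2) 0) with (x := x)
    as [G0 [Gt _]]; try assumption; try lra.
  - intros t y Ht Hy.
    assert (E : forall s, Icc 0 T s -> u1 s y = u2 s y /\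
      Defs.D_x L u1 s y = Defs.D_x L u2 s y).
    { intros s Hs; destruct (B1 s Hs), (B2 s Hs), (Hobs s Hs).
      unfold obs_u, obs_v in *; destruct Hy as [-> | ->]; lra. }
    assert (Et : D_t T u1 t y = D_t T u2 t y).
    { apply Derive_on_eq with (fun s => u2 s y); try assumption.
      - intros s Hs; exact (proj1 (E s Hs)).
      - destruct (js_C2 _ _ _ _ _ _ J2) as [[H2 _] _].
        assert (Hty : rect T L (t, y))
          by (split; [exact Ht|unfold Icc; simpl; destruct Hy; lra]).
        exact (proj1 (H2 t y Hty)). }
    destruct (E t Ht) as [E0 Ex].
    unfold gradient_le; simpl.
    rewrite E0, Ex, Et, !Rminus_diag, Rabs_R0; lra.
  - simpl in G0, Gt; rewrite Rmult_0_r in G0, Gt.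
    destruct (I1 x Hx) as [<- <-]; destruct (I2 x Hx) as [<- <-].
    assert (Hz : forall a b, Rabs (a - b) <= 0 -> a = b).
    { intros a b Hab; apply Rminus_diag_uniq, Rabs_eq_0.
      apply Rle_antisym; [exact Hab|apply Rabs_pos]. }
    split; now apply Hz.
Qed.

Lemma initial_data_norm (K : R -> R -> R) (F : R -> R -> R -> R)
    (T L M : R) (phi psi h hbar : R -> R) (u : R -> R -> R) :
  0 < T -> 0 < L -> solves K F T L phi psi h hbar u ->
  (forall x, Icc 0 L x -> jet_le M (jet_of T L u) 0 x) ->
  C2C1_norm 0 L phi psi <= 5 * M.
Proof.
  intros HT HL Hsol HM.
  pose proof (fun y => initial_condition_jet K F T L phi psi h hbar u y
    HT HL Hsol) as Hd.
  destruct Hsol as [_ [_ [Hic _]]].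
  unfold jet_le in HM; simpl in HM.
  assert (N1 : sup_norm 0 L phi <= M).
  { apply sup_norm_le; [lra|]; intros y Hy.
    rewrite <- (proj1 (Hic y Hy)); exact (proj1 (HM y Hy)). }
  assert (N2 : sup_norm 0 L psi <= M).
  { apply sup_norm_le; [lra|]; intros y Hy.
    rewrite <- (proj2 (Hic y Hy)); exact (proj1 (proj2 (HM y Hy))). }
  assert (N3 : sup_norm 0 L (Derive_on 0 L phi) <= M).
  { apply sup_norm_le; [lra|]; intros y Hy.
    rewrite (proj1 (Hd y Hy)); exact (proj1 (proj2 (proj2 (HM y Hy)))). }
  assert (N4 : sup_norm 0 L (Derive_on 0 L (Derive_on 0 L phi)) <= M).
  { apply sup_norm_le; [lra|]; intros y Hy.
    rewrite (proj1 (proj2 (Hd y Hy)));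
    exact (proj2 (proj2 (proj2 (proj2 (proj2 (HM y Hy)))))). }
  assert (N5 : sup_norm 0 L (Derive_on 0 L psi) <= M).
  { apply sup_norm_le; [lra|]; intros y Hy.
    rewrite (proj2 (proj2 (Hd y Hy)));
    exact (proj1 (proj2 (proj2 (proj2 (proj2 (HM y Hy)))))). }
  unfold C2C1_norm, C2_norm, C1_norm; lra.
Qed.

Theorem theorem5p3 :
  forall (L T r : R) (K : R -> R -> R) (F : R -> R -> R -> R),
  0 < L -> 0 < r ->
  C2_near0 r K ->
  (forall a b, Rabs a < r -> Rabs b < r -> 0 < K_v K a b) ->
  C1_near0 r F ->
  F 0 0 0 = 0 ->
  T > L / sqrt (K_v K 0 0) ->
  exists eps delta C : R, 0 < eps /\ 0 < delta /\ 0 < C /\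
    (* unique determination of the initial data *)
    (forall phi1 psi1 phi2 psi2 h hbar u1 u2,
       small_data K F T L eps phi1 psi1 h hbar ->
       small_data K F T L eps phi2 psi2 h hbar ->
       small_solution K F T L delta phi1 psi1 h hbar u1 ->
       small_solution K F T L delta phi2 psi2 h hbar u2 ->
       (forall t, Icc 0 T t ->
          obs_u u1 t = obs_u u2 t /\ obs_v L u1 t = obs_v L u2 t) ->
       forall x, Icc 0 L x -> phi1 x = phi2 x /\ psi1 x = psi2 x) /\
    (* observability estimate *)
    (forall phi psi h hbar u,
       small_data K F T L eps phi psi h hbar ->
       small_solution K F T L delta phi psi h hbar u ->
       C2C1_norm 0 L phi psi
         <= C * (C2C1_norm 0 T (obs_u u) (obs_v L u) + C2C1_norm 0 T h hbar)).
Proof.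
  intros L T r K F HL Hr HK HKv HF HF0 HT.
  set (c := sqrt (K_v K 0 0)) in *.
  assert (Hc : 0 < c) by (apply sqrt_lt_R0, HKv; rewrite Rabs_R0; exact Hr).
  assert (HT0 : 0 < T) by (assert (0 < L / c) by (apply Rdiv_lt_0_compat; lra); lra).
  assert (HLT : L / T < c).
  { apply Rmult_lt_reg_r with (T / c); [apply Rdiv_lt_0_compat; lra|].
    replace (L / T * (T / c)) with (L / c) by (field; lra).
    replace (c * (T / c)) with T by (field; lra); lra. }
  assert (HLT0 : 0 < L / T) by (apply Rdiv_lt_0_compat; lra).
  (* Strictly between [L / T] and the speed at the origin: the room on the left
     is used by the time translations, that on the right by the variation of
     the speed. *)
  set (c1 := (L / T + c) / 2).
  assert (Hc1 : 0 < c1 < c) by (unfold c1; lra).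
  assert (HLc1 : L < c1 * T).
  { replace L with (L / T * T) by (field; lra).
    apply Rmult_lt_compat_r; unfold c1; lra. }
  destruct (tame_near0 r c1 K F Hr HK HF Hc1) as [r' [B [c2 Htame]]].
  pose proof (tame_r _ _ _ _ _ _ Htame) as Hr'.
  set (d := r' / 2).
  assert (Hd : 0 <= d < r') by (unfold d; lra).
  destruct (initial_jet_estimate K F r' B c1 c2 T L d Htame HF0 HL HLc1 Hd)
    as [C [HC Hest]].
  exists 1, d, (5 * C); split; [lra|split; [unfold d; lra|split; [lra|split]]].
  - intros phi1 psi1 phi2 psi2 h hbar u1 u2 _ _ S1 S2.
    exact (initial_data_unique K F r' B c1 c2 T L d phi1 psi1 phi2 psi2 h hbar
      u1 u2 Htame HL HLc1 Hd S1 S2).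
  - intros phi psi h hbar u _ S.
    pose proof (small_solution_jet K F r' B c1 c2 T L d _ _ _ _ u Htame HT0 HL
      (proj2 Hd) S) as HJ.
    rewrite Rmult_assoc.
    apply (initial_data_norm K F T L _ phi psi h hbar u HT0 HL (proj1 S)).
    set (A := C2C1_norm 0 T (obs_u u) (obs_v L u) + C2C1_norm 0 T h hbar).
    assert (Hlat : forall t x, Icc 0 T t -> x = 0 \/ x = L ->
      lateral_le A (jet_of T L u) t x).
    { intros t x Ht Hx.
      exact (lateral_bound K F T L d phi psi h hbar u t x HT0 HL (proj1 S) HJ
        Ht Hx). }
    apply Hest; [|exact HJ|exact Hlat].
    destruct (Hlat 0 0) as [[H0 _] _]; [unfold Icc; lra|now left|].
    eapply Rle_trans; [apply Rabs_pos|exact H0].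
Qed.
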